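(* For fixed $a\in\mathbb{R}$, the generalized Camassa--Holm equation $$u_t-u_{txx}=-3uu_x+2u_xu_{xx}+uu_{xxx}+a\,u_{xxx}$$ for smooth $u:I\times\mathbb{S}^1\to\mathbb{R}$ is the magnetic Euler--Arnold equation of the magnetic system $(\mathrm{Diff}(\mathbb{S}^1),\mathcal{G}^{H^1},a\cdot c_{\mathrm{GF}})$. In particular, a curve $\gamma$ is a magnetic geodesic of $(\mathrm{Diff}(\mathbb{S}^1),\mathcal{G}^{H^1},c_{\mathrm{GF}})$ of strength $a$ if and only if $(u,a)$ with $u:=\dot\gamma\circ\gamma^{-1}$ is a solution of this equation.
   Context: $\mathbb{S}^1=\mathbb{R}/\mathbb{Z}$, $I=[0,T)$. $\mathrm{Diff}(\mathbb{S}^1)$ is the group of smooth diffeomorphisms of $\mathbb{S}^1$, with $T_{\mathrm{id}}\mathrm{Diff}(\mathbb{S}^1)=\mathfrak{X}(\mathbb{S}^1)$ identified with $C^\infty(\mathbb{S}^1)$. $\mathcal{G}^{H^1}$ is the right-invariant Riemannian metric with $\mathcal{G}^{H^1}_{\mathrm{id}}(u,v)=\int_{\mathbb{S}^1}(uv+u_xv_x)\,dx$. The Gelfand--Fuchs cocycle $c_{\mathrm{GF}}(u,v)=\int_{\mathbb{S}^1}u\,v_{xxx}\,dx$ is regarded as a right-invariant closed two-form on $\mathrm{Diff}(\mathbb{S}^1)$. For a Lie group $G$ with right-invariant metric $\mathcal{G}$ and right-invariant closed two-form $\sigma$ (a magnetic system $(G,\mathcal G,\sigma)$), the Lorentz force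 $Y:TG\to TG$ is defined by $\mathcal{G}_q(Y_qu,v)=\sigma_q(u,v)$, and a smooth curve $\gamma$ is a magnetic geodesic of strength $s$ if $\nabla_{\dot\gamma}\dot\gamma=s\,Y_\gamma\dot\gamma$, with $\nabla$ the Levi-Civita connection of $\mathcal{G}$ (strength $1$ if unspecified). The magnetic Euler--Arnold equation is the evolution equation on $\mathfrak g=T_{\mathrm{id}}G$ satisfied by the Eulerian velocity $u=\dot\gamma\circ\gamma^{-1}$ of a magnetic geodesic $\gamma$.
   Formalization: The Gelfand–Fuchs cocycle is taken with the opposite sign, -∫u v_xxx dx: with G(Yu,v)=σ(u,v) and c_GF=∫u v_xxx dx as stated, the equation would contain -a u_xxx instead of +a u_xxx, so the printed claim fails for a≠0. *)

(* Defs.v *)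
From Stdlib Require Export Reals ClassicalEpsilon.
From Coquelicot Require Export Coquelicot.

Open Scope R_scope.

(** * The circle and its diffeomorphisms

    [S^1 = R/Z], so a function on [S^1] is a 1-periodic function on [R], and
    [C^oo(S^1)] (identified with the vector fields) is [circle_smooth].

    A diffeomorphism of [S^1] is given by a lift [phi : R -> R]; it is unique up
    to an integer constant, and nothing below depends on that constant.  Both
    components of [Diff(S^1)] are included: [phi (x + 1) = phi x + d] with [d = 1]
    (orientation preserving) or [d = -1] (orientation reversing). *)

Definition smooth (f : R -> R) : Prop := forall (n : nat) (x : R), ex_derive_n f n x.

Definition circle_smooth (f : R -> R) : Prop :=
  smooth f /\ forall x, f (x + 1) = f x.

Definition circle_diffeo (phi : R -> R) : Prop :=
  smooth phi /\
  (exists d : R, (d = 1 \/ d = -1) /\ forall x, phi (x + 1) = phi x + d) /\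
  (forall x, Derive phi x <> 0).

(** Lifts are bijections of [R], so this is the two-sided inverse. *)
Definition inverse (phi : R -> R) (y : R) : R :=
  epsilon (inhabits 0) (fun x => phi x = y).

(** * Right-invariant tensors

    As [TS^1] is trivial, the tangent space [T_phi Diff(S^1)], made of the vector
    fields along [phi], is [circle_smooth] for every [phi], and right translation
    to the identity is [U |-> U o phi^-1]. *)

Definition right_invariant (b : (R -> R) -> (R -> R) -> R)
    (phi U V : R -> R) : R :=
  b (fun y => U (inverse phi y)) (fun y => V (inverse phi y)).

Definition H1 (u v : R -> R) : R :=
  RInt (fun x => u x * v x + Derive u x * Derive v x) 0 1.

Definition cGF (u v : R -> R) : R :=
  RInt (fun x => u x * Derive_n v 3 x) 0 1.

(** * Levi-Civita connection and Lorentz force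

    Lifts of diffeomorphisms form an open subset of the union of the affine spaces
    [d * id + C^oo(S^1)], [d = 1] or [-1], and this gives local charts of
    [Diff(S^1)] in which the metric is [G phi U V].  A connection is given there by
    its Christoffel map [Gamma]:
      nabla_W V = D_W V + Gamma_phi (W, V).
    It is Levi-Civita when it is torsion free ([Gamma] symmetric) and
      W (G (U, V)) = G (nabla_W U, V) + G (U, nabla_W V),
    which has to be required only for [U], [V] constant in the chart.  As [G] is
    weakly nondegenerate, these conditions determine [Gamma] (Koszul). *)

Definition tangent_bilinear (Gamma : (R -> R) -> (R -> R) -> R -> R) : Prop :=
  (forall U V, circle_smooth U -> circle_smooth V -> circle_smooth (Gamma U V)) /\
  (forall c U V W, circle_smooth U -> circle_smooth V -> circle_smooth W ->
     forall x,
       Gamma (fun z => c * U z + V z) W x = c * Gamma U W x + Gamma V W x) /\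
  (forall c U V W, circle_smooth U -> circle_smooth V -> circle_smooth W ->
     forall x,
       Gamma U (fun z => c * V z + W z) x = c * Gamma U V x + Gamma U W x).

Definition levi_civita (G : (R -> R) -> (R -> R) -> (R -> R) -> R)
    (Gamma : (R -> R) -> (R -> R) -> (R -> R) -> R -> R) : Prop :=
  forall phi, circle_diffeo phi ->
    tangent_bilinear (Gamma phi) /\
    (forall U V, circle_smooth U -> circle_smooth V ->
       forall x, Gamma phi U V x = Gamma phi V U x) /\
    (forall U V W, circle_smooth U -> circle_smooth V -> circle_smooth W ->
       is_derive (fun eps : R => G (fun x => phi x + eps * W x) U V) 0
         (G phi (Gamma phi W U) V + G phi U (Gamma phi W V))).

Definition lorentz_force (G sigma : (R -> R) -> (R -> R) -> (R -> R) -> R)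
    (Y : (R -> R) -> (R -> R) -> R -> R) : Prop :=
  forall phi U, circle_diffeo phi -> circle_smooth U ->
    circle_smooth (Y phi U) /\
    forall V, circle_smooth V -> G phi (Y phi U) V = sigma phi U V.

(** * Curves on [I = [0, T)], with [0 < T <= +oo]

    Maps on [I] are smooth when they extend smoothly to an open interval
    [(-delta, T)]; the derivative at [t = 0] is then the one-sided one, and does
    not depend on the extension.  A curve is smooth when it is jointly smooth in
    [(t, x)]; [ex_diff_n f n t x] for every [n], on an open set, says that all
    iterated partial derivatives exist and are continuous. *)

Definition dt (f : R -> R -> R) (t x : R) : R := Derive (fun s => f s x) t.
Definition dx (f : R -> R -> R) (t x : R) : R := Derive (fun z => f t z) x.

Definition smooth_curve_in (P : (R -> R) -> Prop) (T : Rbar)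
    (f : R -> R -> R) : Prop :=
  exists delta : R, 0 < delta /\
    forall t, - delta < t -> Rbar_lt t T ->
      P (f t) /\ forall (x : R) (n : nat), ex_diff_n f n t x.

Definition diffeo_curve : Rbar -> (R -> R -> R) -> Prop :=
  smooth_curve_in circle_diffeo.

Definition circle_function_curve : Rbar -> (R -> R -> R) -> Prop :=
  smooth_curve_in circle_smooth.

Definition magnetic_geodesic (T : Rbar)
    (G sigma : (R -> R) -> (R -> R) -> (R -> R) -> R) (s : R)
    (gamma : R -> R -> R) : Prop :=
  diffeo_curve T gamma /\
  exists (Gamma : (R -> R) -> (R -> R) -> (R -> R) -> R -> R)
         (Y : (R -> R) -> (R -> R) -> R -> R),
    levi_civita G Gamma /\ lorentz_force G sigma Y /\
    forall t x, 0 <= t -> Rbar_lt t T ->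
      dt (dt gamma) t x + Gamma (gamma t) (dt gamma t) (dt gamma t) x
      = s * Y (gamma t) (dt gamma t) x.

Definition eulerian_velocity (gamma : R -> R -> R) (t y : R) : R :=
  dt gamma t (inverse (gamma t) y).

(** [E] is the magnetic Euler-Arnold equation of the magnetic system on
    [Diff(S^1)] given by the right-invariant extensions of [g] and [c]. *)
Definition magnetic_Euler_Arnold (T : Rbar)
    (g c : (R -> R) -> (R -> R) -> R) (E : (R -> R -> R) -> Prop) : Prop :=
  forall gamma, diffeo_curve T gamma ->
    (magnetic_geodesic T (right_invariant g) (right_invariant c) 1 gamma <->
     E (eulerian_velocity gamma)).

(** * The generalized Camassa-Holm equation *)

Definition gCH_solution (T : Rbar) (a : R) (u : R -> R -> R) : Prop :=
  circle_function_curve T u /\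
  forall t x, 0 <= t -> Rbar_lt t T ->
    dt u t x - dx (dx (dt u)) t x =
      - 3 * u t x * dx u t x + 2 * dx u t x * dx (dx u) t x
      + u t x * dx (dx (dx u)) t x + a * dx (dx (dx u)) t x.

(** Sign of the cocycle.  Integrating by parts,
      cGF u v = \int u v_xxx = - \int u_xxx v,
    so with the convention [G (Y u, v) = sigma (u, v)] the Lorentz force of [cGF]
    at the identity is [Y u = - (1 - d_x^2)^-1 u_xxx], and [a * cGF] contributes
    [- a u_xxx] to the equation.  The term [+ a u_xxx] of [gCH_solution] belongs
    to the opposite normalization of the Gelfand-Fuchs cocycle,
    [- \int u v_xxx = \int u_x v_xx]. *)
Definition cGF_opp (u v : R -> R) : R := - cGF u v.

(* Main.v *)
From Stdlib Require Import Lra Lia FunctionalExtensionality.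
Require Import Defs.

(** Write [U = u o phi] for the vector field along [phi] with Eulerian representative [u], and
    [D = (1 / phi') d/dx], so that [D^k U = u^(k) o phi].  Changing variables in the right-invariant
    tensors and integrating by parts, the metric is the pairing of [(1 - D^2) U] with [V], the
    variation of the metric is a cubic expression in [D], and the Koszul formula characterizes the
    Levi-Civita map by [(1 - D^2) Gamma (U, V) = D (U V) + D (D U D V) / 2]; likewise the Lorentz
    force of [c * cGF_opp] satisfies [(1 - D^2) Y U = c D^3 U].  As [1 - D^2] is bijective on
    [C^oo(S^1)], a magnetic geodesic is a curve with
      [(1 - D^2) gamma_tt + 2 U D U + D U D^2 U = a D^3 U], where [U = gamma_t],
    and this becomes the Camassa-Holm equation because [gamma_tt = (u_t + u u_x) o gamma].
    The velocity [u] is jointly smooth since functions [F (t, gamma_t^-1 (y))], [F] smooth, are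
    closed under both partial derivatives. *)

(** * Functions smooth on a time strip *)

(** The set [O] restricts time only: the domain is the strip [O] times the whole line, so
    periodicity in space never meets a boundary. *)
Definition Ck (O : R -> Prop) (n : nat) (f : R -> R -> R) : Prop :=
  forall t x, O t -> ex_diff_n f n t x.

Lemma ex_diff_n_S (f : R -> R -> R) (n : nat) (t x : R) :
  ex_diff_n f (S n) t x <->
  continuity_2d_pt f t x /\ ex_derive (fun s => f s x) t /\
  ex_derive (f t) x /\ ex_diff_n (dt f) n t x /\ ex_diff_n (dx f) n t x.
Proof. reflexivity. Qed.

Lemma Ck_le (O : R -> Prop) (m n : nat) (f : R -> R -> R) :
  (m <= n)%nat -> Ck O n f -> Ck O m f.
Proof. intros mn cf t x Ot. now apply (ex_diff_n_m n m mn), cf. Qed.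

Lemma Ck_continuity (O : R -> Prop) (n : nat) (f : R -> R -> R) (t x : R) :
  Ck O n f -> O t -> continuity_2d_pt f t x.
Proof. intros cf Ot. now apply (Ck_le O 0 n f (Nat.le_0_l n)). Qed.

Lemma Ck_S (O : R -> Prop) (n : nat) (f : R -> R -> R) :
  Ck O (S n) f <->
  (forall t x, O t -> continuity_2d_pt f t x) /\
  (forall t x, O t -> ex_derive (fun s => f s x) t) /\
  (forall t x, O t -> ex_derive (f t) x) /\
  Ck O n (dt f) /\ Ck O n (dx f).
Proof.
split.
- intro cf.
  repeat split; intros t x Ot; destruct (proj1 (ex_diff_n_S f n t x) (cf t x Ot))
    as (c & d1 & d2 & c1 & c2); assumption.
- intros (c & d1 & d2 & c1 & c2) t x Ot.
  apply ex_diff_n_S. repeat split; auto.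
Qed.

Lemma open_locally_2d (O : R -> Prop) (t x : R) :
  open O -> O t -> locally_2d (fun s _ => O s) t x.
Proof.
intros oO Ot. destruct (oO t Ot) as [e He].
exists e. intros u v hu _. now apply He.
Qed.

Lemma Ck_ext (O : R -> Prop) (n : nat) (f g : R -> R -> R) :
  open O -> (forall t x, O t -> f t x = g t x) -> Ck O n f -> Ck O n g.
Proof.
intros oO e cf t x Ot. apply (ex_diff_n_ext_loc f); [|now apply cf].
destruct (open_locally_2d O t x oO Ot) as [d Hd].
exists d. intros u v hu hv. apply e, (Hd u v hu hv).
Qed.

Lemma Ck_const (O : R -> Prop) (n : nat) (c : R) : Ck O n (fun _ _ => c).
Proof.
revert c. induction n as [|n IH]; intros c.
- intros t x _. split; [apply continuity_2d_pt_const | exact I].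
- apply Ck_S. repeat split; try (intros; apply ex_derive_const).
  + intros; apply continuity_2d_pt_const.
  + replace (dt (fun _ _ => c)) with (fun _ _ : R => 0); [apply IH|].
    unfold dt. do 2 (apply functional_extensionality; intro). now rewrite Derive_const.
  + replace (dx (fun _ _ => c)) with (fun _ _ : R => 0); [apply IH|].
    unfold dx. do 2 (apply functional_extensionality; intro). now rewrite Derive_const.
Qed.

Lemma Ck_plus (O : R -> Prop) (n : nat) (f g : R -> R -> R) :
  open O -> Ck O n f -> Ck O n g -> Ck O n (fun t x => f t x + g t x).
Proof.
intro oO. revert f g. induction n as [|n IH]; intros f g cf cg.
- intros t x Ot. split; [|exact I].
  apply continuity_2d_pt_plus; [now apply (Ck_continuity O 0 f)|now apply (Ck_continuity O 0 g)].
- apply Ck_S in cf as (c1 & a1 & b1 & d1 & e1).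
  apply Ck_S in cg as (c2 & a2 & b2 & d2 & e2).
  apply Ck_S. repeat split.
  + intros. apply continuity_2d_pt_plus; auto.
  + intros. apply (ex_derive_plus (fun s => f s x) (fun s => g s x)); auto.
  + intros. apply (ex_derive_plus (f t) (g t)); auto.
  + apply (Ck_ext O n (fun t x => dt f t x + dt g t x)); auto.
    intros t x Ot. unfold dt. symmetry. now apply Derive_plus; auto.
  + apply (Ck_ext O n (fun t x => dx f t x + dx g t x)); auto.
    intros t x Ot. unfold dx. symmetry. now apply Derive_plus; auto.
Qed.

Lemma Ck_mult (O : R -> Prop) (n : nat) (f g : R -> R -> R) :
  open O -> Ck O n f -> Ck O n g -> Ck O n (fun t x => f t x * g t x).
Proof.
intro oO. revert f g. induction n as [|n IH]; intros f g cf cg.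
- intros t x Ot. split; [|exact I].
  apply continuity_2d_pt_mult; [now apply (Ck_continuity O 0 f)|now apply (Ck_continuity O 0 g)].
(* The Leibniz rule leaves one factor undifferentiated, so order [n] of [f] and [g] themselves is
   needed besides that of their partial derivatives. *)
- assert (cf' := Ck_le O n (S n) f (Nat.le_succ_diag_r n) cf).
  assert (cg' := Ck_le O n (S n) g (Nat.le_succ_diag_r n) cg).
  apply Ck_S in cf as (c1 & a1 & b1 & d1 & e1).
  apply Ck_S in cg as (c2 & a2 & b2 & d2 & e2).
  apply Ck_S. repeat split.
  + intros. apply continuity_2d_pt_mult; auto.
  + intros. apply (ex_derive_mult (fun s => f s x) (fun s => g s x)); auto.
  + intros. apply (ex_derive_mult (f t) (g t)); auto.
  + apply (Ck_ext O n (fun t x => dt f t x * g t x + f t x * dt g t x)); auto using Ck_plus.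
    intros t x Ot. unfold dt. symmetry.
    now apply (Derive_mult (fun s => f s x) (fun s => g s x)); auto.
  + apply (Ck_ext O n (fun t x => dx f t x * g t x + f t x * dx g t x)); auto using Ck_plus.
    intros t x Ot. unfold dx. symmetry. now apply (Derive_mult (f t) (g t)); auto.
Qed.

Lemma Ck_scal (O : R -> Prop) (n : nat) (c : R) (f : R -> R -> R) :
  open O -> Ck O n f -> Ck O n (fun t x => c * f t x).
Proof. intros oO cf. apply Ck_mult; auto using Ck_const. Qed.

Lemma Ck_inv (O : R -> Prop) (n : nat) (f : R -> R -> R) :
  open O -> (forall t x, O t -> f t x <> 0) -> Ck O n f -> Ck O n (fun t x => / f t x).
Proof.
intros oO nz. induction n as [|n IH]; intros cf.
- intros t x Ot. split; [|exact I].
  apply continuity_2d_pt_inv; [now apply (Ck_continuity O 0 f)|auto].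
(* The derivative -f' (1/f)^2 contains 1/f again; its regularity of order [n] is the induction
   hypothesis. *)
- assert (ci := IH (Ck_le O n (S n) f (Nat.le_succ_diag_r n) cf)).
  apply Ck_S in cf as (c1 & a1 & b1 & d1 & e1).
  apply Ck_S. repeat split.
  + intros. apply continuity_2d_pt_inv; auto.
  + intros. apply (ex_derive_inv (fun s => f s x)); auto.
  + intros. apply (ex_derive_inv (f t)); auto.
  + apply (Ck_ext O n (fun t x => -1 * (dt f t x * (/ f t x * / f t x))));
      auto using Ck_mult, Ck_scal.
    intros t x Ot. unfold dt. rewrite (Derive_inv (fun s => f s x)) by auto.
    cbv beta. field. auto.
  + apply (Ck_ext O n (fun t x => -1 * (dx f t x * (/ f t x * / f t x))));
      auto using Ck_mult, Ck_scal.
    intros t x Ot. unfold dx. rewrite (Derive_inv (f t)) by auto.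
    change (Derive (fun z => f t z) x) with (Derive (f t) x). field. auto.
Qed.

Lemma Ck_div (O : R -> Prop) (n : nat) (f g : R -> R -> R) :
  open O -> (forall t x, O t -> g t x <> 0) -> Ck O n f -> Ck O n g ->
  Ck O n (fun t x => f t x / g t x).
Proof. intros. apply Ck_mult; auto using Ck_inv. Qed.

Definition smooth_on (O : R -> Prop) (f : R -> R -> R) : Prop := forall n, Ck O n f.

Lemma smooth_on_dt (O : R -> Prop) (f : R -> R -> R) : smooth_on O f -> smooth_on O (dt f).
Proof. intros sf n. apply (proj1 (Ck_S O n f) (sf (S n))). Qed.

Lemma smooth_on_dx (O : R -> Prop) (f : R -> R -> R) : smooth_on O f -> smooth_on O (dx f).
Proof. intros sf n. apply (proj1 (Ck_S O n f) (sf (S n))). Qed.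

Lemma smooth_on_ex_dt (O : R -> Prop) (f : R -> R -> R) (t x : R) :
  smooth_on O f -> O t -> ex_derive (fun s => f s x) t.
Proof. intros sf Ot. now apply (proj1 (Ck_S O 0 f) (sf 1%nat)). Qed.

Lemma smooth_on_ex_dx (O : R -> Prop) (f : R -> R -> R) (t x : R) :
  smooth_on O f -> O t -> ex_derive (f t) x.
Proof. intros sf Ot. now apply (proj1 (Ck_S O 0 f) (sf 1%nat)). Qed.

Lemma smooth_on_slice (O : R -> Prop) (f : R -> R -> R) (t : R) :
  smooth_on O f -> O t -> smooth (f t).
Proof.
intros sf Ot n. revert f sf.
induction n as [|n IH]; intros f sf x; [exact I|].
destruct n as [|n].
- now apply (smooth_on_ex_dx O).
- assert (E : Derive_n (dx f t) n = Derive_n (f t) (S n)).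
  { apply functional_extensionality; intro y. unfold dx.
    change (fun x0 => Derive (fun z => f t z) x0) with (Derive_n (f t) 1).
    rewrite Derive_n_comp. f_equal. lia. }
  simpl. change (Derive (Derive_n (f t) n)) with (Derive_n (f t) (S n)).
  change (ex_derive (fun y => Derive_n (f t) (S n) y) x).
  rewrite <- E. apply (IH (dx f) (smooth_on_dx O f sf) x).
Qed.

(** A time derivative that exists nearby and is continuous at the point, together with a space
    derivative at the point alone, already gives total differentiability. *)
Lemma smooth_on_differentiable (O : R -> Prop) (f : R -> R -> R) (t x : R) :
  open O -> smooth_on O f -> O t ->
  differentiable_pt_lim f t x (dt f t x) (dx f t x).
Proof.
intros oO sf Ot. apply filterdiff_differentiable_pt_lim.
apply (is_derive_filterdiff f t x (dt f) (dx f t x)).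
- destruct (oO t Ot) as [e He]. exists e. intros [s y] [hs _]. simpl.
  apply Derive_correct, (smooth_on_ex_dt O); auto.
- apply Derive_correct. now apply (smooth_on_ex_dx O f t x).
- apply continuity_2d_pt_filterlim, (Ck_continuity O 0); [apply (smooth_on_dt O f sf)|auto].
Qed.

(** * Smooth functions of the space variable alone *)

Lemma smooth_Derive (f : R -> R) : smooth f -> smooth (Derive f).
Proof.
intros sf n x.
assert (E : forall m, Derive_n (Derive f) m = Derive_n f (S m)).
{ intro m. apply functional_extensionality; intro y.
  change (Derive f) with (Derive_n f 1). rewrite Derive_n_comp. f_equal. lia. }
destruct n as [|n]; [exact I|]. unfold ex_derive_n. rewrite E.
apply (sf (S (S n)) x).
Qed.

Lemma smooth_ex_derive (f : R -> R) (x : R) : smooth f -> ex_derive f x.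
Proof. intro sf. apply (sf 1%nat x). Qed.

Lemma smooth_continuous (f : R -> R) (x : R) : smooth f -> continuous f x.
Proof. intro sf. now apply (ex_derive_continuous f), smooth_ex_derive. Qed.

Lemma continuity_2d_pt_snd (f : R -> R) (t x : R) :
  continuous f x -> continuity_2d_pt (fun _ y => f y) t x.
Proof.
intro c. apply (continuity_1d_2d_pt_comp f (fun _ y => y)).
- now apply continuity_pt_filterlim.
- apply continuity_2d_pt_id2.
Qed.

(** A function of space is viewed as a time-independent function on the strip of all times, so that
    one-variable closure properties are inherited from the two-variable calculus. *)
Definition everywhere : R -> Prop := fun _ => True.

Lemma open_everywhere : open everywhere.
Proof. apply open_true. Qed.

Lemma Ck_snd_S (n : nat) (f : R -> R) :
  (forall x, ex_derive f x) -> Ck everywhere n (fun _ => Derive f) ->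
  Ck everywhere (S n) (fun _ => f).
Proof.
intros df c. apply Ck_S. repeat split.
- intros. now apply continuity_2d_pt_snd, (ex_derive_continuous f).
- intros. apply ex_derive_const.
- auto.
- replace (dt (fun _ => f)) with (fun _ _ : R => 0); [apply Ck_const|].
  unfold dt. do 2 (apply functional_extensionality; intro). now rewrite Derive_const.
- exact c.
Qed.

Lemma smooth_iff_smooth_on (f : R -> R) :
  smooth f <-> smooth_on everywhere (fun _ => f).
Proof.
split.
- intros sf n. revert f sf. induction n as [|n IH]; intros f sf.
  + intros t x _. split; [|exact I]. now apply continuity_2d_pt_snd, smooth_continuous.
  + apply Ck_snd_S; [intro; now apply smooth_ex_derive|]. now apply IH, smooth_Derive.
- intro sf. now apply (smooth_on_slice everywhere (fun _ => f) 0).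
Qed.

Lemma smooth_plus (f g : R -> R) : smooth f -> smooth g -> smooth (fun x => f x + g x).
Proof.
rewrite !smooth_iff_smooth_on. intros sf sg n.
apply (Ck_plus _ _ (fun _ => f) (fun _ => g)); auto using open_everywhere.
Qed.

Lemma smooth_mult (f g : R -> R) : smooth f -> smooth g -> smooth (fun x => f x * g x).
Proof.
rewrite !smooth_iff_smooth_on. intros sf sg n.
apply (Ck_mult _ _ (fun _ => f) (fun _ => g)); auto using open_everywhere.
Qed.

Lemma smooth_inv (f : R -> R) : (forall x, f x <> 0) -> smooth f -> smooth (fun x => / f x).
Proof.
rewrite !smooth_iff_smooth_on. intros nz sf n.
apply (Ck_inv _ _ (fun _ => f)); auto using open_everywhere.
Qed.

Lemma smooth_const (c : R) : smooth (fun _ => c).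
Proof. apply smooth_iff_smooth_on. intro n. apply Ck_const. Qed.

(* Bootstrapping: the equation turns regularity [n] of [w] into regularity [n + 1]. *)
Lemma smooth_linear_ode (w p q : R -> R) :
  smooth p -> smooth q -> (forall x, is_derive w x (q x + p x * w x)) -> smooth w.
Proof.
rewrite !smooth_iff_smooth_on. intros sp sq dw n.
assert (ew : forall x, ex_derive w x) by (intro x; eexists; apply dw).
assert (Ew : Derive w = fun x => q x + p x * w x).
{ apply functional_extensionality; intro x. now apply is_derive_unique. }
induction n as [|n IH].
- intros t x _. split; [|exact I]. now apply continuity_2d_pt_snd, (ex_derive_continuous w).
- apply Ck_snd_S; [auto|]. rewrite Ew.
  apply (Ck_plus _ _ (fun _ => q) (fun _ x => p x * w x)); auto using open_everywhere.
  apply (Ck_mult _ _ (fun _ => p) (fun _ => w)); auto using open_everywhere.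
Qed.

(** * The inverse of a family of circle diffeomorphisms *)

(** This is the sign [d] hidden under the existential of [circle_diffeo], written as an explicit
    expression in the lift so that it can be multiplied with and differentiated in time. *)
Definition degree (phi : R -> R) : R := phi 1 - phi 0.

Lemma degree_cases (phi : R -> R) : circle_diffeo phi -> degree phi = 1 \/ degree phi = -1.
Proof.
intros (_ & (d & hd & per) & _). unfold degree.
assert (h := per 0). rewrite Rplus_0_l in h. rewrite h.
destruct hd; [left|right]; lra.
Qed.

Lemma degree_shift (phi : R -> R) (x : R) :
  circle_diffeo phi -> phi (x + 1) = phi x + degree phi.
Proof.
intros (_ & (d & hd & per) & _). unfold degree.
assert (h := per 0). rewrite Rplus_0_l in h. rewrite h, per. ring.
Qed.

Lemma smooth_MVT (f : R -> R) (a b : R) :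
  smooth f -> exists c, Rmin a b <= c <= Rmax a b /\ f b - f a = Derive f c * (b - a).
Proof.
intro sf. apply MVT_gen.
- intros. now apply Derive_correct, smooth_ex_derive.
- intros. now apply continuity_pt_filterlim, smooth_continuous.
Qed.

Lemma smooth_continuity (f : R -> R) : smooth f -> continuity f.
Proof. intros sf x. now apply continuity_pt_filterlim, smooth_continuous. Qed.

(** By the mean value theorem the derivative equals the degree somewhere on [0, 1]; a value of the
    other sign would force a zero by the intermediate value theorem. Multiplying by the degree
    treats both orientations at once. *)
Lemma degree_Derive_pos (phi : R -> R) (x : R) :
  circle_diffeo phi -> 0 < degree phi * Derive phi x.
Proof.
intro dphi. assert (hd := degree_cases phi dphi).
destruct dphi as (sphi & _ & nz).
destruct (smooth_MVT phi 0 1 sphi) as (c & _ & Hc).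
fold (degree phi) in Hc. rewrite Rminus_0_r, Rmult_1_r in Hc.
destruct (Rlt_or_le 0 (degree phi * Derive phi x)) as [h|h]; [exact h|exfalso].
destruct (IVT_gen (Derive phi) c x 0) as (z & _ & Hz).
- now apply smooth_continuity, smooth_Derive.
- rewrite <- Hc. unfold Rmin, Rmax.
  destruct (Rle_dec (degree phi) (Derive phi x)); destruct hd as [e|e]; rewrite e in *; lra.
- exact (nz z Hz).
Qed.

Lemma degree_mult_pos (phi : R -> R) (a b : R) :
  circle_diffeo phi -> a < b -> 0 < degree phi * (phi b - phi a).
Proof.
intros dphi ab.
destruct (smooth_MVT phi a b (proj1 dphi)) as (c & _ & ->).
rewrite <- Rmult_assoc. apply Rmult_lt_0_compat; [now apply degree_Derive_pos|lra].
Qed.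

Lemma diffeo_inj (phi : R -> R) (a b : R) : circle_diffeo phi -> phi a = phi b -> a = b.
Proof.
intros dphi e.
destruct (Rtotal_order a b) as [h|[h|h]]; [|exact h|];
  [assert (k := degree_mult_pos phi a b dphi h)|assert (k := degree_mult_pos phi b a dphi h)];
  rewrite e, Rminus_diag, Rmult_0_r in k; lra.
Qed.

Lemma degree_shift_INR (phi : R -> R) (n : nat) (x : R) :
  circle_diffeo phi -> phi (x + INR n) = phi x + INR n * degree phi.
Proof.
intro dphi. induction n as [|n IH].
- simpl. rewrite Rplus_0_r. ring.
- rewrite S_INR. rewrite <- Rplus_assoc, degree_shift, IH by auto. ring.
Qed.

(** The values at -n and n are [phi 0] shifted by n in opposite directions, so for large n they
    enclose [y]. *)
Lemma diffeo_surj (phi : R -> R) (y : R) : circle_diffeo phi -> exists x, phi x = y.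
Proof.
intro dphi.
destruct (INR_unbounded (Rabs (y - phi 0))) as [n Hn].
assert (e1 := degree_shift_INR phi n 0 dphi).
assert (e2 := degree_shift_INR phi n (- INR n) dphi).
rewrite Rplus_0_l in e1. rewrite Rplus_opp_l in e2.
apply Rabs_lt_between in Hn.
destruct (IVT_gen phi (- INR n) (INR n) y) as (x & _ & Hx).
- apply smooth_continuity, dphi.
- unfold Rmin, Rmax. destruct (Rle_dec (phi (- INR n)) (phi (INR n)));
    destruct (degree_cases phi dphi) as [h|h]; rewrite h in *; lra.
- now exists x.
Qed.

Lemma inverse_r (phi : R -> R) (y : R) : circle_diffeo phi -> phi (inverse phi y) = y.
Proof.
intro dphi. apply (epsilon_spec (inhabits 0) (fun x => phi x = y)).
now apply diffeo_surj.
Qed.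

Lemma inverse_l (phi : R -> R) (x : R) : circle_diffeo phi -> inverse phi (phi x) = x.
Proof. intro dphi. apply (diffeo_inj phi); auto using inverse_r. Qed.

Lemma inverse_shift (phi : R -> R) (y : R) :
  circle_diffeo phi -> inverse phi (y + degree phi) = inverse phi y + 1.
Proof.
intro dphi. apply (diffeo_inj phi); auto.
now rewrite degree_shift, !inverse_r.
Qed.

Definition diffeo_on (O : R -> Prop) (g : R -> R -> R) : Prop :=
  open O /\ smooth_on O g /\ forall t, O t -> circle_diffeo (g t).

Lemma diffeo_on_dx (O : R -> Prop) (g : R -> R -> R) (t x : R) :
  diffeo_on O g -> O t -> dx g t x <> 0.
Proof. intros (_ & _ & dg) Ot. apply (dg t Ot). Qed.

Lemma diffeo_on_const (phi : R -> R) :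
  circle_diffeo phi -> diffeo_on everywhere (fun _ => phi).
Proof.
intro dphi. repeat split; [apply open_everywhere|apply smooth_iff_smooth_on|..]; apply dphi.
Qed.

(** By strict monotonicity, [y0] lies strictly between the values at [x0 - e] and [x0 + e]. This
    survives small changes of [t] and [y], and the intermediate value theorem then puts the new
    preimage within [e] of [x0]. *)
Lemma inverse_continuity_2d (O : R -> Prop) (g : R -> R -> R) (t0 y0 : R) :
  diffeo_on O g -> O t0 -> continuity_2d_pt (fun t => inverse (g t)) t0 y0.
Proof.
intros dg Ot0 eps. pose proof dg as (oO & sg & dO).
assert (dg0 := dO t0 Ot0).
set (x0 := inverse (g t0) y0). assert (hx0 : g t0 x0 = y0) by now apply inverse_r.
(* The preimage is found in a closed interval of radius [e]; halving makes the final bound by [eps]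
   strict. *)
set (e := eps / 2). assert (he : 0 < e < eps) by (unfold e; destruct eps; simpl; lra).
assert (m1 := degree_mult_pos (g t0) x0 (x0 + e) dg0 ltac:(lra)).
assert (m2 := degree_mult_pos (g t0) (x0 - e) x0 dg0 ltac:(lra)).
rewrite hx0 in m1, m2.
set (d := degree (g t0)) in *.
assert (hd : d = 1 \/ d = -1) by now apply degree_cases.
(* Half of the smaller gap: [y] and the endpoint value may each move by less than [m] without
   meeting. *)
set (m := Rmin (d * (g t0 (x0 + e) - y0)) (d * (y0 - g t0 (x0 - e))) / 2).
assert (k1 := Rmin_l (d * (g t0 (x0 + e) - y0)) (d * (y0 - g t0 (x0 - e)))).
assert (k2 := Rmin_r (d * (g t0 (x0 + e) - y0)) (d * (y0 - g t0 (x0 - e)))).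
assert (hm : 0 < m).
{ unfold m. apply Rdiv_lt_0_compat; [|lra]. now apply Rmin_glb_lt. }
destruct (Ck_continuity O 0 g t0 (x0 + e) (sg 0%nat) Ot0 (mkposreal m hm)) as [d1 H1].
destruct (Ck_continuity O 0 g t0 (x0 - e) (sg 0%nat) Ot0 (mkposreal m hm)) as [d2 H2].
destruct (oO t0 Ot0) as [d3 H3].
assert (hdel : 0 < Rmin (Rmin d1 d2) (Rmin d3 m)).
{ repeat apply Rmin_glb_lt; auto; apply cond_pos. }
exists (mkposreal _ hdel). simpl. intros t y ht hy.
apply Rmin_Rgt in ht as [ht1 ht2]. apply Rmin_Rgt in ht1 as [ht1 ht1'].
apply Rmin_Rgt in ht2 as [ht2 _].
apply Rmin_Rgt in hy as [_ hy]. apply Rmin_Rgt in hy as [_ hy].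
assert (dt := dO t (H3 t ht2)).
assert (b1 := H1 t (x0 + e) ht1 ltac:(rewrite Rminus_diag, Rabs_R0; apply cond_pos)).
assert (b2 := H2 t (x0 - e) ht1' ltac:(rewrite Rminus_diag, Rabs_R0; apply cond_pos)).
simpl in b1, b2.
apply Rabs_lt_between in b1, b2. apply Rgt_lt, Rabs_lt_between in hy.
destruct (IVT_gen (g t) (x0 - e) (x0 + e) y) as (x & hx & ex).
- apply smooth_continuity, dt.
- unfold m in *. unfold Rmin at 1, Rmax.
  destruct (Rle_dec (g t (x0 - e)) (g t (x0 + e))); destruct hd as [E|E]; rewrite E in *; lra.
- rewrite <- ex, inverse_l by auto. fold x0.
  rewrite Rmin_left, Rmax_right in hx by lra. apply Rabs_lt_between. lra.
Qed.

(** The first-order expansion of [g] at [(t0, x0)] is solved for [x - x0]. Its error is measured in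
    terms of [x - x0] itself, so a Lipschitz bound on the inverse has to come first. *)
Lemma inverse_differentiable (O : R -> Prop) (g : R -> R -> R) (t0 y0 : R) :
  diffeo_on O g -> O t0 ->
  let x0 := inverse (g t0) y0 in
  differentiable_pt_lim (fun t => inverse (g t)) t0 y0
    (- dt g t0 x0 / dx g t0 x0) (/ dx g t0 x0).
Proof.
intros dg Ot0 x0 eps. pose proof dg as (oO & sg & dO).
assert (hx0 : g t0 x0 = y0) by now apply inverse_r, dO.
assert (nz := diffeo_on_dx O g t0 x0 dg Ot0).
assert (Dg := smooth_on_differentiable O g t0 x0 oO sg Ot0).
set (gt := dt g t0 x0) in *. set (gx := dx g t0 x0) in *.
assert (agx := Rabs_pos_lt gx nz). assert (agt := Rabs_pos gt).
set (C := 2 * (1 + Rabs gt + Rabs gx / 2) / Rabs gx).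
assert (hC : 1 <= C).
{ unfold C. apply Rle_div_r; lra. }
(* The first bound lets the error term be absorbed, giving |x - x0| <= C M with M the larger of |t -
   t0| and |y - y0|; the second turns the error e' C M, after division by |gx|, into at most eps
   M. *)
assert (he' : 0 < Rmin (Rabs gx / 2) (eps * Rabs gx / C)).
{ apply Rmin_glb_lt; [lra|]. apply Rdiv_lt_0_compat; [|lra].
  apply Rmult_lt_0_compat; [apply cond_pos|auto]. }
destruct (Dg (mkposreal _ he')) as [d1 H1]. simpl in H1.
destruct (inverse_continuity_2d O g t0 y0 dg Ot0 d1) as [d2 H2].
destruct (oO t0 Ot0) as [d3 H3].
assert (hdel : 0 < Rmin d1 (Rmin d2 d3)).
{ repeat apply Rmin_glb_lt; auto; apply cond_pos. }
exists (mkposreal _ hdel). simpl. intros t y ht hy.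
apply Rmin_Rgt in ht as [ht1 ht2]. apply Rmin_Rgt in ht2 as [ht2 ht3].
apply Rmin_Rgt in hy as [_ hy]. apply Rmin_Rgt in hy as [hy _].
specialize (H2 t y ht2 hy). specialize (H1 t (inverse (g t) y) ht1 H2).
rewrite inverse_r in H1 by (apply dO, H3, ht3). fold x0 in H2 |- *. rewrite hx0 in H1.
set (x := inverse (g t) y) in *.
set (e' := Rmin (Rabs gx / 2) (eps * Rabs gx / C)) in *.
assert (l1 : e' <= Rabs gx / 2) by apply Rmin_l.
assert (l2 : e' <= eps * Rabs gx / C) by apply Rmin_r.
set (M := Rmax (Rabs (t - t0)) (Rabs (y - y0))).
assert (M1 : Rabs (t - t0) <= M) by apply Rmax_l.
assert (M2 : Rabs (y - y0) <= M) by apply Rmax_r.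
assert (hM : 0 <= M) by (eapply Rle_trans; [apply Rabs_pos|exact M1]).
assert (N0 : Rmax (Rabs (t - t0)) (Rabs (x - x0)) <= Rabs (t - t0) + Rabs (x - x0)).
{ apply Rmax_lub; assert (h1 := Rabs_pos (t - t0)); assert (h2 := Rabs_pos (x - x0)); lra. }
(* Half of |gx| |x - x0| is moved to the left-hand side; what remains on the right is (1 + |gt| +
   |gx|/2) M, whence the value of [C]. *)
assert (X : Rabs (x - x0) <= C * M).
{ assert (T : Rabs gx * Rabs (x - x0) <= e' * Rmax (Rabs (t - t0)) (Rabs (x - x0))
      + Rabs (y - y0) + Rabs gt * Rabs (t - t0)).
  { rewrite <- !Rabs_mult.
    replace (gx * (x - x0)) with
      (- (y - y0 - (gt * (t - t0) + gx * (x - x0))) + (y - y0) + - (gt * (t - t0))) by ring.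
    eapply Rle_trans; [apply Rabs_triang|].
    rewrite Rabs_Ropp. apply Rplus_le_compat_r.
    eapply Rle_trans; [apply Rabs_triang|].
    rewrite Rabs_Ropp. apply Rplus_le_compat_r. exact H1. }
  assert (T2 : e' * Rmax (Rabs (t - t0)) (Rabs (x - x0)) <=
     Rabs gx / 2 * (M + Rabs (x - x0))).
  { apply Rmult_le_compat; [lra| |exact l1|lra].
    eapply Rle_trans; [apply Rabs_pos|apply Rmax_l]. }
  assert (T3 : Rabs gt * Rabs (t - t0) <= Rabs gt * M) by (apply Rmult_le_compat_l; lra).
  replace (C * M) with (2 * (1 + Rabs gt + Rabs gx / 2) * M / Rabs gx)
    by (unfold C; field; lra).
  apply Rle_div_r; [lra|]. lra. }
assert (N : Rmax (Rabs (t - t0)) (Rabs (x - x0)) <= C * M).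
{ apply Rmax_lub; [|exact X]. eapply Rle_trans; [exact M1|].
  rewrite <- (Rmult_1_l M) at 1. apply Rmult_le_compat_r; lra. }
replace (x - x0 - (- gt / gx * (t - t0) + / gx * (y - y0))) with
  (- (y - y0 - (gt * (t - t0) + gx * (x - x0))) / gx) by (field; exact nz).
rewrite Rabs_div, Rabs_Ropp by exact nz.
apply Rle_div_l; [lra|].
eapply Rle_trans; [exact H1|].
apply Rle_trans with (eps * Rabs gx / C * (C * M)).
- apply Rmult_le_compat; [lra| |exact l2|exact N].
  eapply Rle_trans; [apply Rabs_pos|apply Rmax_l].
- right. field. lra.
Qed.

(** * Eulerian representatives and their partial derivatives *)

Definition D (phi U : R -> R) (x : R) : R := Derive U x / Derive phi x.

Definition eulerian (g F : R -> R -> R) (t y : R) : R := F t (inverse (g t) y).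

Lemma smooth_on_D (O : R -> Prop) (g F : R -> R -> R) :
  diffeo_on O g -> smooth_on O F -> smooth_on O (fun t => D (g t) (F t)).
Proof.
intros dg sF n. apply (Ck_div O n (dx F) (dx g)).
- apply dg.
- intros t x Ot. now apply (diffeo_on_dx O).
- now apply smooth_on_dx.
- now apply smooth_on_dx, dg.
Qed.

Lemma smooth_on_mult (O : R -> Prop) (f g : R -> R -> R) :
  open O -> smooth_on O f -> smooth_on O g -> smooth_on O (fun t x => f t x * g t x).
Proof. intros oO sf sg n. apply Ck_mult; auto. Qed.

Lemma smooth_on_minus (O : R -> Prop) (f g : R -> R -> R) :
  open O -> smooth_on O f -> smooth_on O g -> smooth_on O (fun t x => f t x - g t x).
Proof.
intros oO sf sg n.
apply (Ck_ext O n (fun t x => f t x + -1 * g t x)); [auto|intros; ring|].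
apply Ck_plus; [auto|auto|apply Ck_scal; auto].
Qed.

(** The time derivative of F(t, g_t^-1(y)) at fixed y, pulled back to x = g_t^-1(y): the subtracted
    term comes from the time derivative -g_t/g_x of the inverse. *)
Definition material (g F : R -> R -> R) (t x : R) : R :=
  dt F t x - D (g t) (F t) x * dt g t x.

Lemma smooth_on_material (O : R -> Prop) (g F : R -> R -> R) :
  diffeo_on O g -> smooth_on O F -> smooth_on O (material g F).
Proof.
intros dg sF. pose proof dg as (oO & sg & _).
apply (smooth_on_minus O (dt F) (fun t x => D (g t) (F t) x * dt g t x)); auto using smooth_on_dt.
apply (smooth_on_mult O (fun t => D (g t) (F t)) (dt g)); auto using smooth_on_dt, smooth_on_D.
Qed.

Lemma eulerian_differentiable (O : R -> Prop) (g F : R -> R -> R) (t y : R) :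
  diffeo_on O g -> smooth_on O F -> O t ->
  differentiable_pt_lim (eulerian g F) t y
    (eulerian g (material g F) t y) (eulerian g (fun t => D (g t) (F t)) t y).
Proof.
intros dg sF Ot.
assert (h := differentiable_pt_lim_comp F (fun u _ => u) (fun t => inverse (g t)) t y _ _ 1 0 _ _
  (smooth_on_differentiable O F t _ (proj1 dg) sF Ot)
  (differentiable_pt_lim_proj1_0 (fun u => u) t y 1 (derivable_pt_lim_id t))
  (inverse_differentiable O g t y dg Ot)).
assert (nz := diffeo_on_dx O g t (inverse (g t) y) dg Ot).
match type of h with differentiable_pt_lim _ _ _ ?a ?b =>
  replace (eulerian g (material g F) t y) with a;
  [replace (eulerian g (fun t => D (g t) (F t)) t y) with b; [exact h|]|] end.
- unfold eulerian, D. change (Derive (F t)) with (dx F t). change (Derive (g t)) with (dx g t).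
  field. exact nz.
- unfold eulerian, material, D.
  change (Derive (F t)) with (dx F t). change (Derive (g t)) with (dx g t). field. exact nz.
Qed.

Lemma eulerian_is_dt (O : R -> Prop) (g F : R -> R -> R) (t y : R) :
  diffeo_on O g -> smooth_on O F -> O t ->
  is_derive (fun s => eulerian g F s y) t (eulerian g (material g F) t y).
Proof.
intros dg sF Ot. apply is_derive_Reals.
assert (h := derivable_pt_lim_comp_2d (eulerian g F) (fun s => s) (fun _ => y) t _ _ 1 0
  (eulerian_differentiable O g F t y dg sF Ot) (derivable_pt_lim_id t) (derivable_pt_lim_const y t)).
now rewrite Rmult_1_r, Rmult_0_r, Rplus_0_r in h.
Qed.

Lemma eulerian_is_dx (O : R -> Prop) (g F : R -> R -> R) (t y : R) :
  diffeo_on O g -> smooth_on O F -> O t ->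
  is_derive (eulerian g F t) y (eulerian g (fun t => D (g t) (F t)) t y).
Proof.
intros dg sF Ot. apply is_derive_Reals.
assert (h := derivable_pt_lim_comp_2d (eulerian g F) (fun _ => t) (fun s => s) y _ _ 0 1
  (eulerian_differentiable O g F t y dg sF Ot) (derivable_pt_lim_const t y) (derivable_pt_lim_id y)).
now rewrite Rmult_1_r, Rmult_0_r, Rplus_0_l in h.
Qed.

Lemma dt_eulerian (O : R -> Prop) (g F : R -> R -> R) (t y : R) :
  diffeo_on O g -> smooth_on O F -> O t ->
  dt (eulerian g F) t y = eulerian g (material g F) t y.
Proof. intros. now apply is_derive_unique, (eulerian_is_dt O). Qed.

Lemma dx_eulerian (O : R -> Prop) (g F : R -> R -> R) (t y : R) :
  diffeo_on O g -> smooth_on O F -> O t ->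
  dx (eulerian g F) t y = eulerian g (fun t => D (g t) (F t)) t y.
Proof. intros. now apply is_derive_unique, (eulerian_is_dx O g F t y). Qed.

(* Functions of the form [eulerian g F] are closed under both partial derivatives. *)
Lemma smooth_on_eulerian (O : R -> Prop) (g F : R -> R -> R) :
  diffeo_on O g -> smooth_on O F -> smooth_on O (eulerian g F).
Proof.
intros dg sF n. revert F sF.
assert (cont : forall F t y, smooth_on O F -> O t -> continuity_2d_pt (eulerian g F) t y).
{ intros F t y sF Ot. apply differentiable_continuity_pt.
  do 2 eexists. now apply (eulerian_differentiable O). }
induction n as [|n IH]; intros F sF.
- intros t x Ot. split; [now apply cont|exact I].
- apply Ck_S. repeat split.
  + auto.
  + intros t y Ot. eexists. now apply (eulerian_is_dt O).
  + intros t y Ot. eexists. now apply (eulerian_is_dx O).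
  + apply (Ck_ext O n (eulerian g (material g F))); [apply dg| |].
    * intros. symmetry. now apply (dt_eulerian O).
    * now apply IH, smooth_on_material.
  + apply (Ck_ext O n (eulerian g (fun t => D (g t) (F t)))); [apply dg| |].
    * intros. symmetry. now apply (dx_eulerian O).
    * now apply IH, smooth_on_D.
Qed.

(** * Calculus on the circle along a diffeomorphism *)

(** The increment [d] makes the lemma serve both lifts of diffeomorphisms and periodic functions,
    where [d] is 0. *)
Lemma Derive_periodic (f : R -> R) (d : R) :
  smooth f -> (forall x, f (x + 1) = f x + d) -> forall x, Derive f (x + 1) = Derive f x.
Proof.
intros sf per x.
assert (h : is_derive (fun y => f (y + 1)) x (1 * Derive f (x + 1))).
{ apply (is_derive_comp f (fun y => y + 1)).
  - now apply Derive_correct, smooth_ex_derive.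
  - auto_derive; [exact I|ring]. }
rewrite Rmult_1_l in h. rewrite <- (is_derive_unique _ _ _ h).
rewrite (Derive_ext _ (fun y => f y + d)) by auto.
rewrite (Derive_plus f (fun _ => d)), Derive_const by (auto using ex_derive_const, smooth_ex_derive).
ring.
Qed.

Lemma circle_smooth_Derive_diffeo (phi : R -> R) :
  circle_diffeo phi -> circle_smooth (Derive phi).
Proof.
intros (sphi & (d & _ & per) & _). split; [now apply smooth_Derive|].
now apply (Derive_periodic phi d).
Qed.

Lemma circle_smooth_Derive (f : R -> R) : circle_smooth f -> circle_smooth (Derive f).
Proof.
intros [sf pf]. split; [now apply smooth_Derive|].
apply (Derive_periodic f 0); auto. intro x. rewrite pf. ring.
Qed.

Lemma circle_smooth_plus (f g : R -> R) :
  circle_smooth f -> circle_smooth g -> circle_smooth (fun x => f x + g x).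
Proof. intros [sf pf] [sg pg]. split; [now apply smooth_plus|intro; now rewrite pf, pg]. Qed.

Lemma circle_smooth_mult (f g : R -> R) :
  circle_smooth f -> circle_smooth g -> circle_smooth (fun x => f x * g x).
Proof. intros [sf pf] [sg pg]. split; [now apply smooth_mult|intro; now rewrite pf, pg]. Qed.

Lemma circle_smooth_scal (c : R) (f : R -> R) :
  circle_smooth f -> circle_smooth (fun x => c * f x).
Proof.
intros [sf pf]. split; [|intro; now rewrite pf].
apply (smooth_mult (fun _ => c)); auto using smooth_const.
Qed.

Lemma circle_smooth_minus (f g : R -> R) :
  circle_smooth f -> circle_smooth g -> circle_smooth (fun x => f x - g x).
Proof.
intros cf cg. replace (fun x => f x - g x) with (fun x => f x + -1 * g x).
- now apply circle_smooth_plus; [|apply circle_smooth_scal].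
- apply functional_extensionality; intro; ring.
Qed.

Lemma circle_smooth_D (phi U : R -> R) :
  circle_diffeo phi -> circle_smooth U -> circle_smooth (D phi U).
Proof.
intros dphi cU.
apply (circle_smooth_mult (Derive U) (fun x => / Derive phi x)); [now apply circle_smooth_Derive|].
destruct (circle_smooth_Derive_diffeo phi dphi) as [s p].
split; [apply smooth_inv; [apply dphi|exact s]|]. intro x. now rewrite p.
Qed.

#[local] Hint Resolve circle_smooth_plus circle_smooth_mult circle_smooth_scal
  circle_smooth_minus circle_smooth_D : csm.

Lemma circle_smooth_ex_derive (f : R -> R) (x : R) : circle_smooth f -> ex_derive f x.
Proof. intros [sf _]. now apply smooth_ex_derive. Qed.

Lemma D_lin (phi U V : R -> R) (c x : R) :
  circle_smooth U -> circle_smooth V ->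
  D phi (fun z => c * U z + V z) x = c * D phi U x + D phi V x.
Proof.
intros cU cV. unfold D.
rewrite (Derive_plus (fun z => c * U z) V), Derive_scal by
  (auto using ex_derive_scal, circle_smooth_ex_derive). unfold Rdiv. ring.
Qed.

Lemma D_plus (phi U V : R -> R) (x : R) :
  circle_smooth U -> circle_smooth V ->
  D phi (fun z => U z + V z) x = D phi U x + D phi V x.
Proof.
intros cU cV. unfold D.
rewrite (Derive_plus U V) by (auto using circle_smooth_ex_derive). unfold Rdiv. ring.
Qed.

Lemma D_minus (phi U V : R -> R) (x : R) :
  circle_smooth U -> circle_smooth V ->
  D phi (fun z => U z - V z) x = D phi U x - D phi V x.
Proof.
intros cU cV. unfold D.
rewrite (Derive_minus U V) by (auto using circle_smooth_ex_derive). unfold Rdiv. ring.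
Qed.

Lemma D_scal (phi U : R -> R) (c x : R) : D phi (fun z => c * U z) x = c * D phi U x.
Proof. unfold D. rewrite Derive_scal. unfold Rdiv. ring. Qed.

Lemma D_mult (phi U V : R -> R) (x : R) :
  circle_smooth U -> circle_smooth V ->
  D phi (fun z => U z * V z) x = D phi U x * V x + U x * D phi V x.
Proof.
intros cU cV. unfold D.
rewrite (Derive_mult U V) by (auto using circle_smooth_ex_derive). unfold Rdiv. ring.
Qed.

(** * Integration over the circle along a diffeomorphism *)

Lemma circle_continuous (f : R -> R) (x : R) : circle_smooth f -> continuous f x.
Proof. intros [sf _]. now apply smooth_continuous. Qed.

Lemma circle_ex_RInt (f : R -> R) (a b : R) : circle_smooth f -> ex_RInt f a b.
Proof.
intro cf. apply (@ex_RInt_continuous R_CompleteNormedModule).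
intros. now apply circle_continuous.
Qed.

(** The path from [a] to [a + 1] is cut at 0 and 1; by periodicity the piece from 1 to [a + 1]
    equals the integral from 0 to [a], which cancels the one from [a] to 0. *)
Lemma RInt_periodic_shift (f : R -> R) (a : R) :
  (forall x, continuous f x) -> (forall x, f (x + 1) = f x) ->
  RInt f a (a + 1) = RInt f 0 1.
Proof.
intros cf pf.
assert (ei : forall u v, ex_RInt f u v)
  by (intros u v; apply (@ex_RInt_continuous R_CompleteNormedModule); auto).
assert (h1 := RInt_Chasles f a 1 (a + 1) (ei _ _) (ei _ _)).
assert (h2 := RInt_Chasles f a 0 1 (ei _ _) (ei _ _)).
assert (h3 := RInt_comp_lin f 1 1 0 a (ei _ _)).
rewrite Rmult_0_r, Rmult_1_l, Rplus_0_l in h3.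
rewrite (RInt_ext _ f) in h3.
- assert (h4 := opp_RInt_swap f 0 a (ei _ _)).
  unfold plus, opp in *. simpl in *. lra.
- intros x _. unfold scal. simpl. unfold mult. simpl. rewrite Rmult_1_l, Rmult_1_l. apply pf.
Qed.

(* [Int phi f] is the integral over the circle of [f o phi^-1]. *)
Definition Int (phi f : R -> R) : R := degree phi * RInt (fun x => f x * Derive phi x) 0 1.

Lemma inverse_continuous (phi : R -> R) (y : R) :
  circle_diffeo phi -> continuous (inverse phi) y.
Proof.
intro dphi.
assert (h := inverse_differentiable everywhere (fun _ => phi) 0 y (diffeo_on_const phi dphi) I).
simpl in h.
apply (ex_derive_continuous (inverse phi)).
eexists. apply is_derive_Reals.
exact (derivable_pt_lim_comp_2d (fun _ => inverse phi) (fun _ => 0) (fun s => s) y _ _ 0 1 h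
  (derivable_pt_lim_const 0 y) (derivable_pt_lim_id y)).
Qed.

Lemma inverse_periodic (phi f : R -> R) (y : R) :
  circle_diffeo phi -> (forall x, f (x + 1) = f x) ->
  f (inverse phi (y + 1)) = f (inverse phi y).
Proof.
intros dphi pf. destruct (degree_cases phi dphi) as [h|h].
- rewrite <- (pf (inverse phi y)), <- inverse_shift by auto. now rewrite h.
- rewrite <- (pf (inverse phi (y + 1))), <- inverse_shift by auto.
  rewrite h. do 2 f_equal. ring.
Qed.

(** The substitution y = phi(x) yields a period starting at [phi 0], traversed backwards when the
    orientation is reversed; the factor [degree phi] in [Int] restores the sign. *)
Lemma RInt_inverse (phi f : R -> R) :
  circle_diffeo phi -> circle_smooth f ->
  RInt (fun y => f (inverse phi y)) 0 1 = Int phi f.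
Proof.
intros dphi cf. set (h := fun y => f (inverse phi y)).
assert (ch : forall y, continuous h y).
{ intro y. apply (continuous_comp (inverse phi) f);
    [now apply inverse_continuous|now apply circle_continuous]. }
assert (ph : forall y, h (y + 1) = h y) by (intro y; apply inverse_periodic; [auto|apply cf]).
assert (e : RInt (fun x => f x * Derive phi x) 0 1 = RInt h (phi 0) (phi 1)).
{ rewrite <- (RInt_comp h phi (Derive phi) 0 1).
  - apply RInt_ext. intros x _. unfold h, scal. simpl. unfold mult. simpl.
    rewrite inverse_l by auto. apply Rmult_comm.
  - auto.
  - intros x _. split.
    + apply Derive_correct, smooth_ex_derive, dphi.
    + apply smooth_continuous, smooth_Derive, dphi. }
unfold Int. rewrite e.
replace (phi 1) with (phi 0 + degree phi) by (unfold degree; ring).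
destruct (degree_cases phi dphi) as [E|E]; rewrite E.
- rewrite (RInt_periodic_shift h (phi 0)) by auto.
  symmetry. apply Rmult_1_l.
- assert (k := RInt_periodic_shift h (phi 0 + -1) ch ph).
  replace (phi 0 + -1 + 1) with (phi 0) in k by ring.
  rewrite <- k. rewrite <- (opp_RInt_swap h).
  + unfold opp. simpl. generalize (RInt h (phi 0) (phi 0 + -1)). simpl. intro r. ring.
  + apply (@ex_RInt_continuous R_CompleteNormedModule); auto.
Qed.

Lemma Int_ext (phi f g : R -> R) : (forall x, f x = g x) -> Int phi f = Int phi g.
Proof. intro e. unfold Int. f_equal. apply RInt_ext. intros x _. now rewrite e. Qed.

Lemma Int_lin (phi f g : R -> R) (c : R) :
  circle_diffeo phi -> circle_smooth f -> circle_smooth g ->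
  Int phi (fun x => c * f x + g x) = c * Int phi f + Int phi g.
Proof.
intros dphi cf cg. assert (cp := circle_smooth_Derive_diffeo phi dphi).
assert (h1 := RInt_scal (fun x => f x * Derive phi x) 0 1 c
  (circle_ex_RInt _ 0 1 (circle_smooth_mult _ _ cf cp))).
assert (h2 := RInt_plus (fun x => c * (f x * Derive phi x)) (fun x => g x * Derive phi x) 0 1
  (circle_ex_RInt _ 0 1 (circle_smooth_scal c _ (circle_smooth_mult _ _ cf cp)))
  (circle_ex_RInt _ 0 1 (circle_smooth_mult _ _ cg cp))).
unfold Int.
rewrite (RInt_ext _ (fun x => plus (c * (f x * Derive phi x)) (g x * Derive phi x))).
- unfold scal, plus in *. simpl in *. unfold mult in *. simpl in *.
  rewrite h2, h1. ring.
- intros x _. unfold plus. simpl. ring.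
Qed.

(** The factor 1/phi' in [D] cancels the Jacobian, leaving the integral of a derivative over a
    period. *)
Lemma Int_D (phi h : R -> R) : circle_diffeo phi -> circle_smooth h -> Int phi (D phi h) = 0.
Proof.
intros dphi ch. unfold Int.
rewrite (RInt_ext _ (Derive h)).
- rewrite RInt_Derive.
  + assert (per := proj2 ch 0). rewrite Rplus_0_l in per. rewrite per. ring.
  + intros. now apply circle_smooth_ex_derive.
  + intros. now apply circle_continuous, circle_smooth_Derive.
- intros x _. change (Derive h x / Derive phi x * Derive phi x = Derive h x).
  field. apply dphi.
Qed.

(** Integration by parts in a form where only the boundary term [h] has to be supplied; the rest is
    the Leibniz rule and ring arithmetic. *)
Lemma Int_eq_mod_D (phi f g h : R -> R) :
  circle_diffeo phi -> circle_smooth g -> circle_smooth h ->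
  (forall x, f x = g x + D phi h x) -> Int phi f = Int phi g.
Proof.
intros dphi cg ch e.
rewrite (Int_ext phi f (fun x => 1 * D phi h x + g x)) by (intro; rewrite e; ring).
rewrite Int_lin, Int_D by auto with csm. ring.
Qed.

Lemma periodic_shift_nat (f : R -> R) (n : nat) (x : R) :
  (forall x, f (x + 1) = f x) -> f (x + INR n) = f x.
Proof.
intro pf. induction n as [|n IH]; [simpl; now rewrite Rplus_0_r|].
now rewrite S_INR, <- Rplus_assoc, pf.
Qed.

Lemma periodic_reduce (f : R -> R) (x : R) :
  (forall x, f (x + 1) = f x) -> exists y, 0 <= y <= 1 /\ f x = f y.
Proof.
intro pf. exists (x - IZR (Int_part x)). split.
- destruct (base_Int_part x). lra.
(* The shift lemma covers natural multiples of the period, so a negative integer part is handled by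
   shifting [x] upwards. *)
- destruct (Z.le_ge_cases 0 (Int_part x)) as [h|h].
  + destruct (IZN _ h) as [n e]. rewrite e, <- INR_IZR_INZ.
    rewrite <- (periodic_shift_nat f n (x - INR n)) by auto. f_equal. ring.
  + destruct (IZN (- Int_part x)) as [n e]; [lia|].
    replace (Int_part x) with (- Z.of_nat n)%Z by lia.
    rewrite opp_IZR, <- INR_IZR_INZ.
    rewrite <- (periodic_shift_nat f n x) by auto. f_equal. ring.
Qed.

Lemma circle_bounded (f : R -> R) :
  circle_smooth f -> exists M, 0 <= M /\ forall x, Rabs (f x) <= M.
Proof.
intros cf.
destruct (continuity_ab_maj (fun x => Rabs (f x)) 0 1) as (m & hm & _); [lra| |].
- intros c _. apply continuity_pt_filterlim.
  apply (continuous_comp f Rabs); [now apply circle_continuous|apply continuous_Rabs].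
- exists (Rabs (f m)). split; [apply Rabs_pos|]. intro x.
  destruct (periodic_reduce f x (proj2 cf)) as (y & hy & ->). now apply hm.
Qed.

(** The integrand weighted by the degree is nonnegative in either orientation. Where [f] is nonzero
    it is positive on a whole interval, which would make the integral positive. *)
Lemma Int_sqr_eq_0 (phi f : R -> R) :
  circle_diffeo phi -> circle_smooth f ->
  Int phi (fun x => f x * f x) <= 0 -> forall x, f x = 0.
Proof.
intros dphi cf hI x.
destruct (periodic_reduce f x (proj2 cf)) as (y & hy & ->). clear x.
set (q := fun x => degree phi * (f x * f x * Derive phi x)).
assert (cq : circle_smooth q)
  by (apply circle_smooth_scal; auto using circle_smooth_Derive_diffeo with csm).
assert (q0 : forall x, 0 <= q x).
{ intro x. unfold q. assert (h := degree_Derive_pos phi x dphi).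
  assert (h' := Rle_0_sqr (f x)). unfold Rsqr in h'.
  replace (degree phi * (f x * f x * Derive phi x)) with
    (f x * f x * (degree phi * Derive phi x)) by ring.
  apply Rmult_le_pos; lra. }
assert (Iq : RInt q 0 1 <= 0).
{ refine (Rle_trans _ _ _ (Req_le _ _ _) hI).
  apply (RInt_scal (fun x => f x * f x * Derive phi x) 0 1 (degree phi)).
  apply (circle_ex_RInt (fun x => f x * f x * Derive phi x)).
  auto using circle_smooth_Derive_diffeo with csm. }
assert (Ip : forall a b, 0 <= a -> a < b -> b <= 1 -> (forall x, a <= x <= b -> 0 < q x) -> False).
{ intros a b h0 hab h1 hq.
  assert (k : 0 < RInt q a b).
  { apply RInt_gt_0; auto; intros; [apply hq; lra|now apply circle_continuous]. }
  assert (c1 := RInt_Chasles q 0 a 1 (circle_ex_RInt _ _ _ cq) (circle_ex_RInt _ _ _ cq)).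
  assert (c2 := RInt_Chasles q a b 1 (circle_ex_RInt _ _ _ cq) (circle_ex_RInt _ _ _ cq)).
  assert (k1 := RInt_ge_0 q 0 a h0 (circle_ex_RInt _ _ _ cq) (fun x _ => q0 x)).
  assert (k2 := RInt_ge_0 q b 1 h1 (circle_ex_RInt _ _ _ cq) (fun x _ => q0 x)).
  unfold plus in *. simpl in *. lra. }
destruct (Req_dec (f y) 0) as [e|ne]; [exact e|exfalso].
assert (qy : 0 < q y).
{ assert (h := degree_Derive_pos phi y dphi). assert (h' := Rsqr_pos_lt _ ne).
  unfold q. replace (degree phi * (f y * f y * Derive phi y)) with
    (Rsqr (f y) * (degree phi * Derive phi y)) by (unfold Rsqr; ring).
  now apply Rmult_lt_0_compat. }
assert (cy := circle_continuous q y cq).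
destruct (cy (fun z => 0 < z) (open_gt 0 (q y) qy)) as [e He].
assert (He' : forall x, Rabs (x - y) < e -> 0 < q x) by (intros x hx; apply He, hx).
assert (he := cond_pos e).
destruct (Rle_lt_dec y (1 / 2)) as [hy2|hy2].
- apply (Ip y (y + Rmin (e / 2) (1 / 2))); try lra;
    assert (m1 := Rmin_l (e / 2) (1 / 2)); assert (m2 := Rmin_r (e / 2) (1 / 2));
    assert (m3 : 0 < Rmin (e / 2) (1 / 2)) by (apply Rmin_glb_lt; lra); try lra.
  intros x hx. apply He', Rabs_lt_between. lra.
- apply (Ip (y - Rmin (e / 2) (1 / 2)) y); try lra;
    assert (m1 := Rmin_l (e / 2) (1 / 2)); assert (m2 := Rmin_r (e / 2) (1 / 2));
    assert (m3 : 0 < Rmin (e / 2) (1 / 2)) by (apply Rmin_glb_lt; lra); try lra.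
  intros x hx. apply He', Rabs_lt_between. lra.
Qed.

(** Variation of constants for w' + p w = F with integrating factor exp P. As exp P is multiplied by
    exp d over a period, with d nonzero, one choice of the integration constant makes the solution
    periodic. *)
Lemma periodic_first_order (p P F : R -> R) (d : R) :
  circle_smooth p -> circle_smooth F -> (forall x, is_derive P x (p x)) ->
  d <> 0 -> (forall x, P (x + 1) = P x + d) ->
  exists w, circle_smooth w /\ forall x, is_derive w x (F x - p x * w x).
Proof.
intros cp cF dP nz per.
set (f := fun x => exp (P x) * F x).
assert (cf : forall x, continuous f x).
{ intro x. apply (continuous_mult (fun x => exp (P x)) F); [|now apply circle_continuous].
  apply (continuous_comp P exp); [apply (ex_derive_continuous P); eexists; apply dP|].
  apply (ex_derive_continuous exp). eexists. apply is_derive_exp. }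
assert (ei : forall u v, ex_RInt f u v)
  by (intros u v; apply (@ex_RInt_continuous R_CompleteNormedModule); auto).
assert (nz' : exp d - 1 <> 0).
{ intro h. apply nz, exp_inv. rewrite exp_0. lra. }
set (J := RInt f 0 1).
(* Periodicity requires K + J + exp d I(x) = exp d (K + I(x)), where I(x) is the integral of [f]
   from 0 to x; hence K = J / (exp d - 1). *)
set (w := fun x => exp (- P x) * (J / (exp d - 1) + RInt f 0 x)).
assert (dw : forall x, is_derive w x (F x - p x * w x)).
{ intro x.
  assert (dI : is_derive (RInt f 0) x (f x)).
  { apply (is_derive_RInt f (RInt f 0) 0 x); [|auto].
    apply filter_forall. intro z. apply (@RInt_correct R_CompleteNormedModule), ei. }
  assert (d1 : is_derive (fun x => exp (- P x)) x (- p x * exp (- P x))).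
  { apply (is_derive_comp exp (fun x => - P x)); [apply is_derive_exp|].
    apply (is_derive_opp P), dP. }
  assert (d2 : is_derive (fun x => J / (exp d - 1) + RInt f 0 x) x (0 + f x)).
  { apply (is_derive_plus (fun _ => J / (exp d - 1)) (RInt f 0));
      [exact (is_derive_const (J / (exp d - 1) : R_NormedModule) x)|exact dI]. }
  assert (d3 := is_derive_mult _ _ x _ _ d1 d2 Rmult_comm).
  unfold plus, mult in d3. simpl in d3.
  match type of d3 with is_derive _ _ ?l => replace (F x - p x * w x) with l; [exact d3|] end.
  unfold w, f. rewrite exp_Ropp. field.
  split; [exact nz'|apply Rgt_not_eq, exp_pos]. }
exists w. split; [split|exact dw].
- apply (smooth_linear_ode w (fun x => -1 * p x) F).
  + apply (circle_smooth_scal (-1) p cp).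
  + apply cF.
  + intro x. replace (F x + -1 * p x * w x) with (F x - p x * w x) by ring. apply dw.
- intro x. unfold w.
  assert (h1 := RInt_Chasles f 0 1 (x + 1) (ei _ _) (ei _ _)).
  assert (h2 := RInt_comp_lin f 1 1 0 x (ei _ _)).
  rewrite Rmult_0_r, Rmult_1_l, Rplus_0_l in h2.
  rewrite (RInt_ext _ (fun y => scal (exp d) (f y))) in h2.
  + assert (h3 : exp d * RInt f 0 x = RInt f 1 (x + 1))
      by exact (eq_trans (eq_sym (RInt_scal f 0 x (exp d) (ei _ _))) h2).
    change (J + RInt f 1 (x + 1) = RInt f 0 (x + 1)) in h1.
    rewrite <- h1, <- h3, per.
    replace (- (P x + d)) with (- P x + - d) by ring. rewrite exp_plus, (exp_Ropp d).
    field. split; [exact nz'|apply Rgt_not_eq, exp_pos].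
  + intros y _. unfold scal. simpl. unfold mult. simpl. unfold f.
    rewrite !Rmult_1_l, per, exp_plus, (proj2 cF). ring.
Qed.

(** * The metric, its variation, and the operator [1 - D^2] *)

Lemma Derive_inverse (phi V : R -> R) :
  circle_diffeo phi -> smooth V ->
  Derive (fun y => V (inverse phi y)) = (fun y => D phi V (inverse phi y)).
Proof.
intros dphi sV. apply functional_extensionality; intro y.
apply (dx_eulerian everywhere (fun _ => phi) (fun _ => V) 0 y);
  [|now apply smooth_iff_smooth_on|exact I].
now apply diffeo_on_const.
Qed.

Lemma H1_Int (phi U V : R -> R) :
  circle_diffeo phi -> circle_smooth U -> circle_smooth V ->
  right_invariant H1 phi U V = Int phi (fun x => U x * V x + D phi U x * D phi V x).
Proof.
intros dphi cU cV. unfold right_invariant, H1.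
rewrite !Derive_inverse by (auto; apply cU || apply cV).
apply (RInt_inverse phi (fun x => U x * V x + D phi U x * D phi V x)); auto 10 with csm.
Qed.

Lemma H1_sym (phi U V : R -> R) :
  right_invariant H1 phi U V = right_invariant H1 phi V U.
Proof.
unfold right_invariant, H1. apply RInt_ext. intros x _. f_equal; apply Rmult_comm.
Qed.

Definition helmholtz (phi Z : R -> R) (x : R) : R := Z x - D phi (D phi Z) x.

Lemma circle_smooth_helmholtz (phi Z : R -> R) :
  circle_diffeo phi -> circle_smooth Z -> circle_smooth (helmholtz phi Z).
Proof. intros. apply (circle_smooth_minus Z (D phi (D phi Z))); auto 10 with csm. Qed.

#[local] Hint Resolve circle_smooth_helmholtz : csm.

Lemma helmholtz_lin (phi U V : R -> R) (c x : R) :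
  circle_diffeo phi -> circle_smooth U -> circle_smooth V ->
  helmholtz phi (fun z => c * U z + V z) x = c * helmholtz phi U x + helmholtz phi V x.
Proof.
intros dphi cU cV. unfold helmholtz.
replace (D phi (fun z => c * U z + V z)) with (fun z => c * D phi U z + D phi V z)
  by (apply functional_extensionality; intro; now rewrite D_lin).
rewrite D_lin by auto 10 with csm. ring.
Qed.

Lemma H1_helmholtz (phi Z W : R -> R) :
  circle_diffeo phi -> circle_smooth Z -> circle_smooth W ->
  right_invariant H1 phi Z W = Int phi (fun x => helmholtz phi Z x * W x).
Proof.
intros dphi cZ cW. rewrite H1_Int by auto.
apply (Int_eq_mod_D phi _ _ (fun x => D phi Z x * W x)); auto 10 with csm.
intro x. rewrite D_mult by auto 10 with csm. unfold helmholtz. ring.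
Qed.

Lemma cGF_opp_Int (phi U V : R -> R) :
  circle_diffeo phi -> circle_smooth U -> circle_smooth V ->
  right_invariant cGF_opp phi U V = Int phi (fun x => D phi (D phi (D phi U)) x * V x).
Proof.
intros dphi cU cV.
assert (e : right_invariant cGF phi U V = Int phi (fun x => U x * D phi (D phi (D phi V)) x)).
{ unfold right_invariant, cGF. simpl.
  change (fun x => Derive (fun y => V (inverse phi y)) x)
    with (Derive (fun y => V (inverse phi y))).
  rewrite Derive_inverse by (auto; apply cV).
  change (fun x => Derive (fun y => D phi V (inverse phi y)) x)
    with (Derive (fun y => D phi V (inverse phi y))).
  rewrite Derive_inverse by (auto; now apply circle_smooth_D).
  rewrite Derive_inverse by (auto; now apply circle_smooth_D, circle_smooth_D).
  apply (RInt_inverse phi (fun x => U x * D phi (D phi (D phi V)) x)); auto 10 with csm. }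
unfold right_invariant, cGF_opp in *. rewrite e.
set (f := fun x => U x * D phi (D phi (D phi V)) x).
assert (cf : circle_smooth f) by (unfold f; auto 10 with csm).
assert (c0 : circle_smooth (fun x => 0 * f x)) by auto 10 with csm.
(* The negation is brought to the shape of [Int_lin] with a zero second summand, whose integral
   vanishes because it is also a [D]-derivative. *)
transitivity (Int phi (fun x => -1 * f x + 0 * f x)).
- rewrite Int_lin by auto.
  rewrite (Int_ext phi (fun x => 0 * f x) (D phi (fun x => 0 * f x))) by
    (intro x; rewrite D_scal; ring).
  rewrite Int_D by auto. ring.
- symmetry.
  (* This is the boundary term of three integrations by parts: its [D]-derivative telescopes to D^3
     U V + U D^3 V. *)
  apply (Int_eq_mod_D phi _ _ (fun x => D phi (D phi U) x * V x - D phi U x * D phi V x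
    + U x * D phi (D phi V) x)); auto 10 with csm.
  intro x.
  rewrite D_plus, D_minus, !D_mult by auto 10 with csm. unfold f. ring.
Qed.

(** The test field is [A - B] itself. *)
Lemma Int_nondegenerate (phi A B : R -> R) :
  circle_diffeo phi -> circle_smooth A -> circle_smooth B ->
  (forall W, circle_smooth W -> Int phi (fun x => A x * W x) = Int phi (fun x => B x * W x)) ->
  forall x, A x = B x.
Proof.
intros dphi cA cB h x. apply Rminus_diag_uniq.
apply (Int_sqr_eq_0 phi (fun x => A x - B x)); auto 10 with csm.
set (W := fun x => A x - B x). assert (cW : circle_smooth W) by (unfold W; auto 10 with csm).
rewrite (Int_ext phi _ (fun x => -1 * (B x * W x) + A x * W x)) by (intro; unfold W; ring).
rewrite Int_lin, h by auto 10 with csm. lra.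
Qed.

Lemma Int_sqr_ge_0 (phi f : R -> R) :
  circle_diffeo phi -> circle_smooth f -> 0 <= Int phi (fun x => f x * f x).
Proof.
intros dphi cf. unfold Int.
assert (cg : circle_smooth (fun x => f x * f x * Derive phi x))
  by auto using circle_smooth_Derive_diffeo with csm.
refine (Rle_trans _ _ _ _
  (Req_le _ _ (RInt_scal (fun x => f x * f x * Derive phi x) 0 1 (degree phi) _))).
- apply RInt_ge_0; [lra| |].
  + apply (circle_ex_RInt (fun x => degree phi * (f x * f x * Derive phi x))); auto 10 with csm.
  + intros x _. change (0 <= degree phi * (f x * f x * Derive phi x)).
    replace (degree phi * (f x * f x * Derive phi x))
      with (f x * f x * (degree phi * Derive phi x)) by ring.
    apply Rmult_le_pos; [apply Rle_0_sqr|now apply Rlt_le, degree_Derive_pos].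
- now apply (circle_ex_RInt (fun x => f x * f x * Derive phi x)).
Qed.

(** Energy argument: pairing (1 - D^2) Z = 0 with Z = U - V shows that the integral of Z^2 + (D Z)^2
    vanishes. *)
Lemma helmholtz_inj (phi U V : R -> R) :
  circle_diffeo phi -> circle_smooth U -> circle_smooth V ->
  (forall x, helmholtz phi U x = helmholtz phi V x) -> forall x, U x = V x.
Proof.
intros dphi cU cV e x.
set (Z := fun x => -1 * V x + U x).
assert (cZ : circle_smooth Z) by (unfold Z; auto 10 with csm).
enough (h : Z x = 0) by (unfold Z in h; lra).
apply (Int_sqr_eq_0 phi Z); auto.
assert (h0 : Int phi (fun x => 1 * (D phi Z x * D phi Z x) + Z x * Z x) =
  Int phi (D phi (fun x => 0 * Z x))).
{ rewrite (Int_ext phi _ (fun x => Z x * Z x + D phi Z x * D phi Z x)) by (intro; ring).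
  rewrite <- H1_Int, H1_helmholtz by auto. apply Int_ext. intro y.
  unfold Z at 1. rewrite helmholtz_lin, e, D_scal by auto. ring. }
rewrite Int_lin, Int_D in h0 by auto 10 with csm.
assert (h1 := Int_sqr_ge_0 phi (D phi Z) dphi (circle_smooth_D _ _ dphi cZ)). lra.
Qed.

(* [1 - D^2 = (1 - D) (1 + D)] *)
Lemma helmholtz_surj (phi F : R -> R) :
  circle_diffeo phi -> circle_smooth F ->
  exists Z, circle_smooth Z /\ forall x, helmholtz phi Z x = F x.
Proof.
intros dphi cF.
assert (cp := circle_smooth_Derive_diffeo phi dphi).
assert (nzd : degree phi <> 0) by (destruct (degree_cases phi dphi); lra).
assert (dP : forall x, is_derive phi x (Derive phi x)).
{ intro x. apply Derive_correct, smooth_ex_derive, dphi. }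
assert (nz : forall x, Derive phi x <> 0) by apply dphi.
(* First (1 + D) w = F is solved with integrating factor exp phi, then (1 - D) z = w with exp(-phi);
   the increments over a period are the degree and its opposite. *)
destruct (periodic_first_order (Derive phi) phi (fun x => Derive phi x * F x) (degree phi))
  as (w & cw & Hw); auto using degree_shift with csm.
destruct (periodic_first_order (fun x => -1 * Derive phi x) (fun x => - phi x)
  (fun x => -1 * (Derive phi x * w x)) (- degree phi)) as (z & cz & Hz); auto 10 with csm.
- intro x. replace (-1 * Derive phi x) with (- Derive phi x) by ring.
  apply (is_derive_opp phi x), dP.
- lra.
- intro x. rewrite degree_shift by auto. ring.
- exists z. split; [exact cz|]. intro x.
  assert (Dz : D phi z = fun x => z x - w x).
  { apply functional_extensionality; intro y. unfold D.
    rewrite (is_derive_unique _ _ _ (Hz y)). field. apply nz. }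
  assert (Dw : D phi w x = F x - w x).
  { unfold D. rewrite (is_derive_unique _ _ _ (Hw x)). field. apply nz. }
  unfold helmholtz. rewrite Dz, D_minus, Dz, Dw by auto. ring.
Qed.

Definition helmholtz_inv (phi F : R -> R) : R -> R :=
  epsilon (inhabits F) (fun Z => circle_smooth Z /\ forall x, helmholtz phi Z x = F x).

Lemma helmholtz_inv_spec (phi F : R -> R) :
  circle_diffeo phi -> circle_smooth F ->
  circle_smooth (helmholtz_inv phi F) /\ forall x, helmholtz phi (helmholtz_inv phi F) x = F x.
Proof.
intros dphi cF.
apply (epsilon_spec (inhabits F) (fun Z => circle_smooth Z /\ forall x, helmholtz phi Z x = F x)).
now apply helmholtz_surj.
Qed.

(** Differentiation under the integral sign for the metric along phi + s W. The two factors [D]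
    contribute 1/phi' twice and the Jacobian phi' once, so the terms are A = U V times the weight
    and B = U' V' over it, with p = phi' and q = W'. *)
Lemma is_derive_inverse_weight (A B p q : R -> R) (e : posreal) :
  (forall x, continuous A x) -> (forall x, continuous B x) ->
  (forall x, continuous p x) -> (forall x, continuous q x) ->
  (forall s x, Rabs s < e -> p x + s * q x <> 0) ->
  is_derive (fun s => RInt (fun x => A x * (p x + s * q x) + B x / (p x + s * q x)) 0 1) 0
    (RInt (fun x => A x * q x - B x * q x / (p x) ^ 2) 0 1).
Proof.
intros cA cB cp cq nz.
set (f := fun s x => A x * (p x + s * q x) + B x / (p x + s * q x)).
set (df := fun s x => A x * q x - B x * q x * / ((p x + s * q x) * (p x + s * q x))).
assert (dfs : forall s x, Rabs s < e -> is_derive (fun s => f s x) s (df s x)).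
{ intros s x hs. assert (h := nz s x hs). unfold f, df. auto_derive; [exact h|field; exact h]. }
assert (cw : forall s x, continuity_2d_pt (fun s x => p x + s * q x) s x).
{ intros s x. apply continuity_2d_pt_plus; [now apply continuity_2d_pt_snd|].
  apply continuity_2d_pt_mult; [apply continuity_2d_pt_id1|now apply continuity_2d_pt_snd]. }
assert (h : is_derive (fun s => RInt (f s) 0 1) 0 (RInt (fun x => Derive (fun s => f s x) 0) 0 1)).
{ apply (is_derive_RInt_param f 0 1 0).
  - exists e. intros s hs x _. eexists. apply dfs.
    unfold ball in hs. simpl in hs. unfold AbsRing_ball, abs, minus, plus, opp in hs. simpl in hs.
    now rewrite Ropp_0, Rplus_0_r in hs.
  - intros x _. apply (continuity_2d_pt_ext_loc df).
    + exists e. intros s y hs _. rewrite Rminus_0_r in hs. symmetry.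
      now apply is_derive_unique, dfs.
    + assert (h0 : p x + 0 * q x <> 0) by (apply nz; rewrite Rabs_R0; apply cond_pos).
      unfold df. apply continuity_2d_pt_minus.
      * apply (continuity_2d_pt_mult (fun _ => A) (fun _ => q)); now apply continuity_2d_pt_snd.
      * apply (continuity_2d_pt_mult (fun _ x => B x * q x)
          (fun s x => / ((p x + s * q x) * (p x + s * q x)))).
        -- apply (continuity_2d_pt_mult (fun _ => B) (fun _ => q)); now apply continuity_2d_pt_snd.
        -- apply continuity_2d_pt_inv; [|now apply Rmult_integral_contrapositive_currified].
           now apply continuity_2d_pt_mult.
  - exists e. intros s hs. apply (@ex_RInt_continuous R_CompleteNormedModule). intros x _.
    assert (hs' : Rabs s < e).
    { unfold ball in hs. simpl in hs. unfold AbsRing_ball, abs, minus, plus, opp in hs. simpl in hs.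
      now rewrite Ropp_0, Rplus_0_r in hs. }
    assert (cpq : continuous (fun x => p x + s * q x) x).
    { apply (continuous_plus p (fun x => s * q x)); [auto|].
      apply (continuous_mult (fun _ => s) q); [apply continuous_const|auto]. }
    apply (continuous_plus (fun x => A x * (p x + s * q x)) (fun x => B x / (p x + s * q x))).
    + now apply (continuous_mult A).
    + apply (continuous_mult B (fun x => / (p x + s * q x))); [auto|].
      apply continuous_Rinv_comp; auto. }
replace (RInt (fun x => A x * q x - B x * q x / (p x) ^ 2) 0 1)
  with (RInt (fun x => Derive (fun s => f s x) 0) 0 1); [exact h|].
apply RInt_ext. intros x _.
assert (h0 : p x + 0 * q x <> 0) by (apply nz; rewrite Rabs_R0; apply cond_pos).
refine (eq_trans (is_derive_unique _ _ _ (dfs 0 x ltac:(rewrite Rabs_R0; apply cond_pos))) _).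
unfold df. rewrite Rmult_0_l, Rplus_0_r in *.
change (A x * q x - B x * q x * / (p x * p x) = A x * q x - B x * q x / (p x) ^ 2).
field. exact h0.
Qed.

(** The derivative factors as phi' (1 + s D W), and D W is bounded by some M, so |s| < 1/(M + 1)
    keeps the second factor positive. *)
Lemma diffeo_perturbation (phi W : R -> R) :
  circle_diffeo phi -> circle_smooth W ->
  exists e : posreal, forall s, Rabs s < e -> circle_diffeo (fun x => phi x + s * W x).
Proof.
intros dphi cW.
destruct (circle_bounded (D phi W)) as (M & M0 & HM); [auto 10 with csm|].
assert (he : 0 < / (M + 1)) by (apply Rinv_0_lt_compat; lra).
exists (mkposreal _ he). simpl. intros s hs.
split; [|split].
- apply smooth_plus; [apply dphi|apply circle_smooth_scal, cW].
- exists (degree phi). split; [now apply degree_cases|].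
  intro x. rewrite degree_shift, (proj2 cW) by auto. ring.
- intro x.
  rewrite (Derive_plus phi (fun x => s * W x)), Derive_scal by
    (auto using ex_derive_scal, circle_smooth_ex_derive; apply smooth_ex_derive, dphi).
  assert (nz : Derive phi x <> 0) by apply dphi.
  replace (Derive phi x + s * Derive W x) with (Derive phi x * (1 + s * D phi W x))
    by (unfold D; field; exact nz).
  apply Rmult_integral_contrapositive_currified; [exact nz|].
  assert (h : Rabs (s * D phi W x) < 1).
  { rewrite Rabs_mult. apply Rle_lt_trans with (Rabs s * M).
    - apply Rmult_le_compat_l; [apply Rabs_pos|apply HM].
    - apply Rle_lt_trans with (/ (M + 1) * M); [apply Rmult_le_compat_r; lra|].
      rewrite Rmult_comm. apply Rlt_div_l; lra. }
  apply Rabs_lt_between in h. lra.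
Qed.

Lemma H1_variation (phi U V W : R -> R) :
  circle_diffeo phi -> circle_smooth U -> circle_smooth V -> circle_smooth W ->
  is_derive (fun s : R => right_invariant H1 (fun x => phi x + s * W x) U V) 0
    (Int phi (fun x => U x * V x * D phi W x - D phi U x * D phi V x * D phi W x)).
Proof.
intros dphi cU cV cW.
destruct (diffeo_perturbation phi W dphi cW) as [e He].
set (A := fun x => U x * V x). set (B := fun x => Derive U x * Derive V x).
assert (Dp : forall s x, Derive (fun x => phi x + s * W x) x = Derive phi x + s * Derive W x).
{ intros s x. rewrite (Derive_plus phi (fun x => s * W x)), Derive_scal by
    (auto using ex_derive_scal, circle_smooth_ex_derive; apply smooth_ex_derive, dphi).
  reflexivity. }
assert (nz : forall s x, Rabs s < e -> Derive phi x + s * Derive W x <> 0).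
{ intros s x hs. rewrite <- Dp. apply (He s hs). }
apply (is_derive_ext_loc (fun s => degree phi * RInt (fun x => A x * (Derive phi x + s * Derive W x)
  + B x / (Derive phi x + s * Derive W x)) 0 1)).
- exists e. intros s hs.
  unfold ball in hs. simpl in hs. unfold AbsRing_ball, abs, minus, plus, opp in hs. simpl in hs.
  rewrite Ropp_0, Rplus_0_r in hs.
  rewrite H1_Int by auto. unfold Int. f_equal.
  + unfold degree. assert (h := proj2 cW 0). rewrite Rplus_0_l in h. rewrite h. ring.
  + apply RInt_ext. intros x _. unfold D. rewrite Dp.
    change (A x * (Derive phi x + s * Derive W x) + B x / (Derive phi x + s * Derive W x) =
      (U x * V x + Derive U x / (Derive phi x + s * Derive W x) *
        (Derive V x / (Derive phi x + s * Derive W x))) * (Derive phi x + s * Derive W x)).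
    unfold A, B. field. now apply nz.
- assert (h := is_derive_inverse_weight A B (Derive phi) (Derive W) e).
  unfold Int.
  replace (RInt (fun x =>
    (U x * V x * D phi W x - D phi U x * D phi V x * D phi W x) * Derive phi x) 0 1)
    with (RInt (fun x => A x * Derive W x - B x * Derive W x / (Derive phi x) ^ 2) 0 1).
  + apply (is_derive_scal (fun s => RInt (fun x => A x * (Derive phi x + s * Derive W x)
      + B x / (Derive phi x + s * Derive W x)) 0 1)).
    apply h; auto.
    * intro x. apply circle_continuous. unfold A. auto 10 with csm.
    * intro x. apply circle_continuous. unfold B. auto using circle_smooth_Derive with csm.
    * intro x. now apply circle_continuous, circle_smooth_Derive_diffeo.
    * intro x. now apply circle_continuous, circle_smooth_Derive.
  + apply RInt_ext. intros x _.
    change (A x * Derive W x - B x * Derive W x / (Derive phi x) ^ 2 =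
      (U x * V x * D phi W x - D phi U x * D phi V x * D phi W x) * Derive phi x).
    unfold A, B, D. field. apply dphi.
Qed.

(** * Levi-Civita connection and Lorentz force *)

Lemma Int_plus (phi f g : R -> R) :
  circle_diffeo phi -> circle_smooth f -> circle_smooth g ->
  Int phi (fun x => f x + g x) = Int phi f + Int phi g.
Proof.
intros dphi cf cg.
rewrite (Int_ext phi _ (fun x => 1 * f x + g x)), Int_lin by (auto; intro; ring). ring.
Qed.

(* [(1 - d_x^2)] of the Christoffel map at the identity, transported to [phi]; by the Koszul
   formula it is [(uv)_x + (u_x v_x)_x / 2]. *)
Definition koszul (phi U V : R -> R) (x : R) : R :=
  U x * D phi V x + V x * D phi U x +
  1 / 2 * (D phi (D phi U) x * D phi V x + D phi U x * D phi (D phi V) x).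

Lemma circle_smooth_koszul (phi U V : R -> R) :
  circle_diffeo phi -> circle_smooth U -> circle_smooth V -> circle_smooth (koszul phi U V).
Proof.
intros dphi cU cV.
unfold koszul. auto 10 with csm.
Qed.

#[local] Hint Resolve circle_smooth_koszul : csm.

Lemma koszul_sym (phi U V : R -> R) : koszul phi U V = koszul phi V U.
Proof. apply functional_extensionality; intro x. unfold koszul. ring. Qed.

Lemma koszul_lin_l (phi U V W : R -> R) (c x : R) :
  circle_diffeo phi -> circle_smooth U -> circle_smooth V ->
  koszul phi (fun z => c * U z + V z) W x = c * koszul phi U W x + koszul phi V W x.
Proof.
intros dphi cU cV. unfold koszul.
replace (D phi (fun z => c * U z + V z)) with (fun z => c * D phi U z + D phi V z)
  by (apply functional_extensionality; intro; now rewrite D_lin).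
rewrite D_lin by auto with csm. ring.
Qed.

Lemma H1_helmholtz_r (phi Z W : R -> R) :
  circle_diffeo phi -> circle_smooth Z -> circle_smooth W ->
  right_invariant H1 phi W Z = Int phi (fun x => helmholtz phi Z x * W x).
Proof. intros. rewrite H1_sym. now apply H1_helmholtz. Qed.

(** Koszul's argument: compatibility is written for the three cyclic permutations of the fields, and
    symmetry of [Gamma] reduces S1 + S2 - S3 to twice the pairing of [Gamma phi U V] with W.
    Nondegeneracy then removes W. *)
Lemma levi_civita_koszul (Gamma : (R -> R) -> (R -> R) -> (R -> R) -> R -> R) (phi U V : R -> R) :
  levi_civita (right_invariant H1) Gamma ->
  circle_diffeo phi -> circle_smooth U -> circle_smooth V ->
  forall x, helmholtz phi (Gamma phi U V) x = koszul phi U V x.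
Proof.
intros LC dphi cU cV. destruct (LC phi dphi) as ((smo & _) & sym & comp).
assert (symE : forall U V, circle_smooth U -> circle_smooth V -> Gamma phi U V = Gamma phi V U).
{ intros U' V' h1 h2. apply functional_extensionality. auto. }
assert (var : forall U V W, circle_smooth U -> circle_smooth V -> circle_smooth W ->
  right_invariant H1 phi (Gamma phi W U) V + right_invariant H1 phi U (Gamma phi W V) =
  Int phi (fun x => U x * V x * D phi W x - D phi U x * D phi V x * D phi W x)).
{ intros U' V' W' h1 h2 h3.
  transitivity (Derive (fun s => right_invariant H1 (fun x => phi x + s * W' x) U' V') 0).
  - symmetry. now apply is_derive_unique, comp.
  - now apply is_derive_unique, H1_variation. }
apply (Int_nondegenerate phi); auto with csm.
intros W cW.
assert (v1 := var V W U cV cW cU).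
assert (v2 := var W U V cW cU cV).
assert (v3 := var U V W cU cV cW).
rewrite (symE V W), (symE V U) in v2 by auto.
rewrite (symE W U) in v3 by auto.
rewrite (H1_sym phi V) in v1.
rewrite (H1_sym phi W), (H1_sym phi (Gamma phi W V)) in v2.
rewrite <- H1_helmholtz by auto.
set (S1 := fun x => V x * W x * D phi U x - D phi V x * D phi W x * D phi U x) in *.
set (S2 := fun x => W x * U x * D phi V x - D phi W x * D phi U x * D phi V x) in *.
set (S3 := fun x => U x * V x * D phi W x - D phi U x * D phi V x * D phi W x) in *.
assert (c1 : circle_smooth S1) by (unfold S1; auto 10 with csm).
assert (c2 : circle_smooth S2) by (unfold S2; auto 10 with csm).
assert (c3 : circle_smooth S3) by (unfold S3; auto 10 with csm).
assert (cK : circle_smooth (fun x => koszul phi U V x * W x)) by auto with csm.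
assert (key : Int phi (fun x => -1 * S3 x + (S1 x + S2 x)) =
  Int phi (fun x => koszul phi U V x * W x + koszul phi U V x * W x)).
(* This boundary term absorbs every summand in which W is differentiated. *)
{ apply (Int_eq_mod_D phi _ _ (fun x => -1 * (U x * V x * W x + D phi U x * D phi V x * W x)));
    auto 10 with csm.
  intro x. rewrite D_scal, D_plus, (D_mult phi (fun x => U x * V x)),
    (D_mult phi (fun x => D phi U x * D phi V x)), !D_mult by auto 10 with csm.
  unfold S1, S2, S3, koszul. field. }
rewrite Int_lin, !Int_plus in key by auto with csm.
lra.
Qed.

Lemma levi_civita_exists :
  levi_civita (right_invariant H1) (fun phi U V => helmholtz_inv phi (koszul phi U V)).
Proof.
intros phi dphi.
assert (sp : forall U V, circle_smooth U -> circle_smooth V ->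
  circle_smooth (helmholtz_inv phi (koszul phi U V)) /\
  forall x, helmholtz phi (helmholtz_inv phi (koszul phi U V)) x = koszul phi U V x)
  by (intros; apply helmholtz_inv_spec; auto with csm).
assert (lin : forall c U V W, circle_smooth U -> circle_smooth V -> circle_smooth W ->
  forall x, helmholtz_inv phi (koszul phi (fun z => c * U z + V z) W) x =
    c * helmholtz_inv phi (koszul phi U W) x + helmholtz_inv phi (koszul phi V W) x).
{ intros c U V W cU cV cW.
  destruct (sp U W cU cW) as [c1 e1]. destruct (sp V W cV cW) as [c2 e2].
  destruct (sp (fun z => c * U z + V z) W) as [c3 e3]; auto with csm.
  (* The inverse is only a chosen preimage, so its linearity is derived from that of the right-hand
     side by injectivity of 1 - D^2. *)
  apply (helmholtz_inj phi _ (fun x => c * helmholtz_inv phi (koszul phi U W) x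
    + helmholtz_inv phi (koszul phi V W) x)); auto with csm.
  intro x. rewrite helmholtz_lin, e1, e2, e3 by auto. now apply koszul_lin_l. }
split; [split; [|split]|split].
- intros U V cU cV. now apply sp.
- exact lin.
- intros c U V W cU cV cW x. rewrite !(koszul_sym phi U). now apply lin.
- intros U V cU cV x. now rewrite koszul_sym.
- intros U V W cU cV cW.
  destruct (sp W U cW cU) as [c1 e1]. destruct (sp W V cW cV) as [c2 e2].
  replace (right_invariant H1 phi (helmholtz_inv phi (koszul phi W U)) V +
    right_invariant H1 phi U (helmholtz_inv phi (koszul phi W V))) with
    (Int phi (fun x => U x * V x * D phi W x - D phi U x * D phi V x * D phi W x));
    [now apply H1_variation|].
  rewrite H1_helmholtz, H1_helmholtz_r, <- Int_plus by auto with csm.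
  symmetry.
  apply (Int_eq_mod_D phi _ _ (fun x => W x * U x * V x +
    1 / 2 * (D phi W x * D phi U x * V x + D phi W x * D phi V x * U x))); auto 10 with csm.
  intro x. rewrite e1, e2.
    rewrite (D_plus phi (fun x => W x * U x * V x)), D_scal,
      (D_plus phi (fun x => D phi W x * D phi U x * V x)),
      (D_mult phi (fun x => W x * U x)), (D_mult phi (fun x => D phi W x * D phi U x)),
      (D_mult phi (fun x => D phi W x * D phi V x)), !D_mult by auto 10 with csm.
  unfold koszul. field.
Qed.

(** The factor [c] is kept apart from the strength [s]: only the product [s * c] enters the
    equation, so one lemma covers a scaled form with strength 1 and the plain form with strength
    [a]. *)
Definition cocycle (c : R) (phi U V : R -> R) : R := c * right_invariant cGF_opp phi U V.

Lemma lorentz_force_helmholtz (c : R) (Y : (R -> R) -> (R -> R) -> R -> R) (phi U : R -> R) :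
  lorentz_force (right_invariant H1) (cocycle c) Y ->
  circle_diffeo phi -> circle_smooth U ->
  forall x, helmholtz phi (Y phi U) x = c * D phi (D phi (D phi U)) x.
Proof.
intros LF dphi cU. destruct (LF phi U dphi cU) as [cY hY].
apply (Int_nondegenerate phi); auto 10 with csm.
intros W cW. rewrite <- H1_helmholtz, hY by auto.
unfold cocycle. rewrite cGF_opp_Int by auto.
set (f := fun x => D phi (D phi (D phi U)) x * W x).
assert (cf : circle_smooth f) by (unfold f; auto 10 with csm).
rewrite (Int_ext phi (fun x => c * D phi (D phi (D phi U)) x * W x)
  (fun x => c * f x + D phi (fun y => 0 * f y) x)) by (intro; rewrite D_scal; unfold f; ring).
rewrite Int_lin, Int_D by auto with csm. ring.
Qed.

Lemma lorentz_force_exists (c : R) :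
  lorentz_force (right_invariant H1) (cocycle c)
    (fun phi U => helmholtz_inv phi (fun x => c * D phi (D phi (D phi U)) x)).
Proof.
intros phi U dphi cU.
destruct (helmholtz_inv_spec phi (fun x => c * D phi (D phi (D phi U)) x)) as [cY hY];
  auto 10 with csm.
split; [exact cY|]. intros V cV.
rewrite H1_helmholtz by auto. unfold cocycle. rewrite cGF_opp_Int by auto.
set (f := fun x => D phi (D phi (D phi U)) x * V x).
assert (cf : circle_smooth f) by (unfold f; auto 10 with csm).
rewrite (Int_ext phi _ (fun x => c * f x + D phi (fun y => 0 * f y) x))
  by (intro; rewrite hY, D_scal; unfold f; ring).
rewrite Int_lin, Int_D by auto with csm. ring.
Qed.

(** * Geodesics in Eulerian coordinates *)

Lemma diffeo_curve_diffeo_on (T : Rbar) (gamma : R -> R -> R) :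
  diffeo_curve T gamma ->
  exists delta : R, 0 < delta /\ diffeo_on (fun t => - delta < t /\ Rbar_lt t T) gamma.
Proof.
intros (delta & hd & h). exists delta. split; [exact hd|split; [|split]].
- apply open_and; [apply open_gt|].
  destruct T; simpl; [apply open_lt|apply open_true|apply open_false].
- intros n t x [h1 h2]. now apply h.
- intros t [h1 h2]. now apply h.
Qed.

(* The degree squares to 1, so its time derivative vanishes. *)
Lemma circle_smooth_velocity (O : R -> Prop) (g : R -> R -> R) (t : R) :
  diffeo_on O g -> O t -> circle_smooth (dt g t).
Proof.
intros dg Ot. pose proof dg as (oO & sg & dO).
split; [now apply (smooth_on_slice O), Ot; apply smooth_on_dt|].
assert (dd : forall x, is_derive (fun s => g s x) t (dt g t x)).
{ intro x. apply Derive_correct. now apply (smooth_on_ex_dt O). }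
set (k := dt g t 1 - dt g t 0).
assert (d1 : is_derive (fun s => degree (g s)) t k).
{ apply (is_derive_minus (fun s => g s 1) (fun s => g s 0)); apply dd. }
assert (d2 : is_derive (fun s => degree (g s) * degree (g s)) t
  (k * degree (g t) + degree (g t) * k)).
{ exact (is_derive_mult _ _ t _ _ d1 d1 Rmult_comm). }
assert (d3 : is_derive (fun s => degree (g s) * degree (g s)) t 0).
{ apply (is_derive_ext_loc (fun _ => 1)); [|exact (is_derive_const (1 : R_NormedModule) t)].
  destruct (oO t Ot) as [e He]. exists e. intros s hs.
  change (1 = degree (g s) * degree (g s)).
  destruct (degree_cases (g s) (dO s (He s hs))) as [h|h]; rewrite h; ring. }
assert (k0 : k = 0).
{ apply is_derive_unique in d2. apply is_derive_unique in d3. rewrite d2 in d3.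
  destruct (degree_cases (g t) (dO t Ot)) as [h|h]; rewrite h in d3; lra. }
intro x. transitivity (dt g t x + k); [|rewrite k0; ring].
apply is_derive_unique.
apply (is_derive_ext_loc (fun s => g s x + degree (g s))).
- destruct (oO t Ot) as [e He]. exists e. intros s hs.
  symmetry. apply degree_shift, dO, He, hs.
- apply (is_derive_plus (fun s => g s x)); [apply dd|exact d1].
Qed.

Lemma circle_smooth_acceleration (O : R -> Prop) (g : R -> R -> R) (t : R) :
  diffeo_on O g -> O t -> circle_smooth (dt (dt g) t).
Proof.
intros dg Ot. pose proof dg as (oO & sg & dO).
split; [now apply (smooth_on_slice O), Ot; do 2 apply smooth_on_dt|].
intro x. apply Derive_ext_loc.
destruct (oO t Ot) as [e He]. exists e. intros s hs.
apply (circle_smooth_velocity O g s dg (He s hs)).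
Qed.

(** Agreement on the single time slice [t] suffices for a space derivative, so the conclusion can be
    fed back in to reach higher derivatives. *)
Lemma dx_eulerian_eq (O : R -> Prop) (g F h : R -> R -> R) (t : R) :
  diffeo_on O g -> smooth_on O F -> O t ->
  (forall y, h t y = eulerian g F t y) ->
  forall y, dx h t y = eulerian g (fun t => D (g t) (F t)) t y.
Proof.
intros dg sF Ot e y. rewrite <- (dx_eulerian O) by auto.
apply Derive_ext. exact e.
Qed.

(** Pulled back to x, u_t becomes V - U D U with V the acceleration, and (1 - D^2)(U D U) = U D U -
    3 D U D^2 U - U D^3 U. The terms in U D^3 U cancel, and what is left of the quadratic terms is 2
    U D U + D U D^2 U, the diagonal of [koszul]. *)
Lemma gCH_lagrangian (O : R -> Prop) (g : R -> R -> R) (a t x : R) :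
  diffeo_on O g -> O t ->
  let u := eulerian_velocity g in let y := g t x in
  let U := dt g t in let phi := g t in
  (dt u t y - dx (dx (dt u)) t y =
      - 3 * u t y * dx u t y + 2 * dx u t y * dx (dx u) t y
      + u t y * dx (dx (dx u)) t y + a * dx (dx (dx u)) t y) <->
  helmholtz phi (dt (dt g) t) x + koszul phi U U x = a * D phi (D phi (D phi U)) x.
Proof.
intros dg Ot u y U phi. pose proof dg as (oO & sg & dO).
assert (dphi : circle_diffeo phi) by now apply dO.
assert (s0 := smooth_on_dt O g sg).
assert (s1 := smooth_on_D O g _ dg s0).
assert (s2 := smooth_on_D O g _ dg s1).
assert (m0 := smooth_on_material O g _ dg s0).
assert (m1 := smooth_on_D O g _ dg m0).
assert (e0 : forall y, u t y = eulerian g (dt g) t y) by reflexivity.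
assert (e1 := dx_eulerian_eq O g _ u t dg s0 Ot e0).
assert (e2 := dx_eulerian_eq O g _ (dx u) t dg s1 Ot e1).
assert (e3 := dx_eulerian_eq O g _ (dx (dx u)) t dg s2 Ot e2).
assert (f0 := fun y => dt_eulerian O g _ t y dg s0 Ot).
assert (f1 := dx_eulerian_eq O g _ (dt u) t dg m0 Ot f0).
assert (f2 := dx_eulerian_eq O g _ (dx (dt u)) t dg m1 Ot f1).
change (eulerian g (dt g)) with u in f0.
rewrite f0, f2, e3, e2, e1, e0.
unfold eulerian, y. rewrite inverse_l by exact dphi.
change (g t) with phi. change (dt g t) with U. set (V := dt (dt g) t).
assert (cU : circle_smooth U) by now apply (circle_smooth_velocity O).
assert (cV : circle_smooth V) by now apply (circle_smooth_acceleration O).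
change (material g (dt g) t) with (fun x => V x - D phi U x * U x).
assert (DM : D phi (fun x => V x - D phi U x * U x) =
  fun x => D phi V x - (D phi (D phi U) x * U x + D phi U x * D phi U x)).
{ apply functional_extensionality; intro z.
  rewrite D_minus, D_mult by auto 10 with csm. reflexivity. }
rewrite DM, D_minus, D_plus, !D_mult by auto 10 with csm.
unfold helmholtz, koszul. split; intro h; lra.
Qed.

Lemma circle_function_curve_velocity (T : Rbar) (gamma : R -> R -> R) :
  diffeo_curve T gamma -> circle_function_curve T (eulerian_velocity gamma).
Proof.
intro dg. destruct (diffeo_curve_diffeo_on T gamma dg) as (delta & hd & dO).
exists delta. split; [exact hd|]. intros t h1 h2.
set (O := fun t => - delta < t /\ Rbar_lt t T) in *.
assert (Ot : O t) by now split.
assert (su : smooth_on O (eulerian_velocity gamma)).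
{ apply (smooth_on_eulerian O gamma (dt gamma) dO), smooth_on_dt, dO. }
split; [split|].
- now apply (smooth_on_slice O).
- intro y. apply inverse_periodic; [now apply dO|].
  apply (circle_smooth_velocity O gamma t dO Ot).
- intros x n. now apply su.
Qed.

Lemma helmholtz_comb (phi N Y : R -> R) (s x : R) :
  circle_diffeo phi -> circle_smooth N -> circle_smooth Y ->
  helmholtz phi (fun x => s * Y x + -1 * N x) x =
  s * helmholtz phi Y x - helmholtz phi N x.
Proof.
intros dphi cN cY. rewrite helmholtz_lin by auto with csm.
unfold helmholtz at 2.
replace (D phi (fun z => -1 * N z)) with (fun z => -1 * D phi N z)
  by (apply functional_extensionality; intro; now rewrite D_scal).
rewrite D_scal. unfold helmholtz. ring.
Qed.

(** Forwards, 1 - D^2 is applied to the geodesic equation, whatever connection and force witness it.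
    Backwards, the constructed connection and force are supplied and 1 - D^2 is cancelled by
    injectivity. *)
Lemma magnetic_geodesic_gCH (T : Rbar) (s c : R) (gamma : R -> R -> R) :
  diffeo_curve T gamma ->
  magnetic_geodesic T (right_invariant H1) (cocycle c) s gamma <->
  gCH_solution T (s * c) (eulerian_velocity gamma).
Proof.
intro dg. destruct (diffeo_curve_diffeo_on T gamma dg) as (delta & hd & dO).
set (O := fun t => - delta < t /\ Rbar_lt t T) in *.
assert (inO : forall t, 0 <= t -> Rbar_lt t T -> O t) by (intros; split; [lra|auto]).
assert (cU : forall t, O t -> circle_smooth (dt gamma t))
  by (intros; now apply (circle_smooth_velocity O)).
assert (cV : forall t, O t -> circle_smooth (dt (dt gamma) t))
  by (intros; now apply (circle_smooth_acceleration O)).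
assert (dphi : forall t, O t -> circle_diffeo (gamma t)) by apply dO.
split.
- intros (_ & Gamma & Y & LC & LF & eqn). split; [now apply circle_function_curve_velocity|].
  intros t y ht hT. assert (Ot := inO t ht hT).
  (* Every point of the circle is some [gamma t x], so the Eulerian equation may be tested in
     Lagrangian coordinates. *)
  rewrite <- (inverse_r (gamma t) y) by auto. generalize (inverse (gamma t) y). clear y. intro x.
  apply (gCH_lagrangian O gamma (s * c) t x dO Ot).
  assert (E : dt (dt gamma) t = fun x => s * Y (gamma t) (dt gamma t) x
    + -1 * Gamma (gamma t) (dt gamma t) (dt gamma t) x).
  { apply functional_extensionality; intro z. rewrite <- eqn by auto. ring. }
  rewrite E, helmholtz_comb; auto.
  + rewrite (levi_civita_koszul Gamma), (lorentz_force_helmholtz c Y) by auto. ring.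
  + apply (LC (gamma t)); auto.
  + apply LF; auto.
- intros (_ & eqn). split; [exact dg|].
  exists (fun phi U V => helmholtz_inv phi (koszul phi U V)),
    (fun phi U => helmholtz_inv phi (fun x => c * D phi (D phi (D phi U)) x)).
  split; [exact levi_civita_exists|]. split; [exact (lorentz_force_exists c)|].
  intros t x ht hT. assert (Ot := inO t ht hT).
  destruct (helmholtz_inv_spec (gamma t) (koszul (gamma t) (dt gamma t) (dt gamma t)))
    as [cN hN]; auto with csm.
  destruct (helmholtz_inv_spec (gamma t)
    (fun x => c * D (gamma t) (D (gamma t) (D (gamma t) (dt gamma t))) x))
    as [cY hY]; auto 10 with csm.
  set (N := helmholtz_inv (gamma t) (koszul (gamma t) (dt gamma t) (dt gamma t))) in *.
  set (Y := helmholtz_inv (gamma t)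
    (fun x => c * D (gamma t) (D (gamma t) (D (gamma t) (dt gamma t))) x)) in *.
  enough (h : dt (dt gamma) t x = s * Y x + -1 * N x) by lra.
  revert x.
  apply (helmholtz_inj (gamma t) _ (fun x => s * Y x + -1 * N x)); auto with csm.
  intro x. rewrite helmholtz_comb, hN, hY by auto.
  assert (h := proj1 (gCH_lagrangian O gamma (s * c) t x dO Ot) (eqn t (gamma t x) ht hT)).
  lra.
Qed.

Theorem corollary4p8 (a : R) (T : Rbar) (hT : Rbar_lt 0 T) :
  magnetic_Euler_Arnold T H1 (fun u v => a * cGF_opp u v) (gCH_solution T a) /\
  (forall gamma : R -> R -> R, diffeo_curve T gamma ->
     (magnetic_geodesic T (right_invariant H1) (right_invariant cGF_opp) a gamma <->
      gCH_solution T a (eulerian_velocity gamma))).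
Proof.
split; intros gamma dg.
(* Scaling a form commutes with right translation by computation, so [cocycle a] is convertible to
   the required tensor; for the plain form below, the factor 1 has to be removed by
   extensionality. *)
- assert (h := magnetic_geodesic_gCH T 1 a gamma dg). rewrite Rmult_1_l in h. exact h.
- assert (h := magnetic_geodesic_gCH T a 1 gamma dg). rewrite Rmult_1_r in h.
  replace (right_invariant cGF_opp) with (cocycle 1); [exact h|].
  unfold cocycle. do 3 (apply functional_extensionality; intro). apply Rmult_1_l.
Qed.
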